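(* Let $3\le n\le\infty$ and let $\Gamma\le\mathrm{Sym}(n)$. The kaleidoscopic group $\mathcal{K}(\Gamma)$, viewed as a subgroup of $\mathrm{Sym}(\mathrm{Br}(D_n))$, is closed in $\mathrm{Sym}(\mathrm{Br}(D_n))$ if and only if $\Gamma$ is closed in $\mathrm{Sym}(n)$ (which is automatic when $n<\infty$). Here both symmetric groups carry the topology of pointwise convergence.
   Context: A dendrite is a locally connected continuum (non-empty compact connected metrizable space) containing no simple closed curve. Any two distinct points $x,y$ of a dendrite $X$ are joined by a unique arc $[x,y]$; put $(x,y)=[x,y]\setminus\{x,y\}$. For $x\in X$, $\widehat{x}=\pi_0(X\setminus\{x\})$ is the (at most countable) set of components of $X\setminus\{x\}$; $x$ is a branch point if $|\widehat{x}|\ge 3$, and $\mathrm{Br}(X)$ is the (at most countable) set of branch points. For $3\le n\le\infty$ ($\infty$ meaning countably infinite), the Ważewski dendrite $D_n$ is the dendrite, unique up to homeomorphism, which is not a single point, in which $|\widehat{x}|=n$ for every branch point $x$, and in which $(x,y)$ contains a branch point for all $x\ne y$. Write $[n]=\{m\in\mathbf{N}: m<n\}$ (so $[\infty]=\mathbf{N}\ni 0$) and $\mathrm{Sym}(n)$ for the group of all permutations of $[n]$. The action on branch points embeds $\mathrm{Homeo}(D_n)$ in $\mathrm{Sym}(\mathrm{Br}(D_n))$, and this embedding is an isomorphism of topological groups onto its image. A coloring of $D_n$ is a map $c$ from $\widehat{D_n}=\bigsqcup_{x\in\mathrm{Br}(D_n)}\widehat{x}$ to $[n]$ whose restriction $c_x=c|_{\widehat{x}}$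 is a bijection $\widehat{x}\to[n]$ for each $x\in \mathrm{Br}(D_n)$; for $y\ne x$, $c_x(y)$ denotes the color of the component of $D_n\setminus\{x\}$ containing $y$. The coloring is kaleidoscopic if for all distinct $x,y\in\mathrm{Br}(D_n)$ and all distinct $i,j\in[n]$ there is $z\in(x,y)\cap\mathrm{Br}(D_n)$ with $c_z(x)=i$ and $c_z(y)=j$. For $g\in\mathrm{Homeo}(D_n)$ and $x\in\mathrm{Br}(D_n)$ put $\sigma_c(g,x)=c_{g(x)}\circ g\circ c_x^{-1}\in\mathrm{Sym}(n)$, where $g$ is viewed as a bijection $\widehat{x}\to\widehat{g(x)}$. For $\Gamma\le\mathrm{Sym}(n)$ put $\mathcal{K}_c(\Gamma)=\{g\in\mathrm{Homeo}(D_n):\sigma_c(g,x)\in\Gamma\ \text{for all } x\in\mathrm{Br}(D_n)\}$. Kaleidoscopic colorings exist and for any two of them, $c$ and $d$, the groups $\mathcal{K}_c(\Gamma)$ and $\mathcal{K}_d(\Gamma)$ are conjugate in $\mathrm{Homeo}(D_n)$; $\mathcal{K}(\Gamma)$ denotes $\mathcal{K}_c(\Gamma)$ for some (any) kaleidoscopic coloring $c$. *)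

(* Defs.v *)
From HB Require Import structures.
From mathcomp Require Import all_boot all_order all_algebra.
From mathcomp Require Import all_classical all_reals all_analysis.
Set Implicit Arguments.
Unset Strict Implicit.
Unset Printing Implicit Defensive.
Import Order.TTheory GRing.Theory Num.Theory.
Import numFieldNormedType.Exports.
Local Open Scope classical_set_scope.
Local Open Scope ring_scope.

(* As a [set_type] of the function space with values in discrete [T], [Sym T]
   inherits the topology of pointwise convergence. *)
Definition Sym (T : choiceType) : Type :=
  set_type [set f : {ptws T -> discrete_topology T} | bijective f].

HB.instance Definition _ (T : choiceType) := Topological.on (Sym T).

Section SymGroup.
Variable T : choiceType.
Implicit Types s t : Sym T.

Definition Sym_fun s : T -> T := set_val s.

Lemma Sym_bij s : bijective (Sym_fun s).
Proof. exact: (set_valP s). Qed.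

Definition mk_Sym (f : T -> T) (fbij : bijective f) : Sym T :=
  exist _ (f : {ptws T -> discrete_topology T}) (mem_set fbij).

Lemma Sym_funK s t : Sym_fun s =1 Sym_fun t -> s = t.
Proof. by move=> st; apply: val_inj; exact/funext. Qed.

Lemma Sym_inv_exists s :
  exists g : T -> T, cancel (Sym_fun s) g /\ cancel g (Sym_fun s).
Proof. by have [g sK gK] := Sym_bij s; exists g. Qed.

Definition Sym_invfun s : T -> T := projT1 (cid (Sym_inv_exists s)).

Lemma Sym_invfunP s :
  cancel (Sym_fun s) (Sym_invfun s) /\ cancel (Sym_invfun s) (Sym_fun s).
Proof. exact: (projT2 (cid (Sym_inv_exists s))). Qed.

Lemma id_bij : bijective (@id T).
Proof. by exists id. Qed.

Lemma Sym_invfun_bij s : bijective (Sym_invfun s).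
Proof. by have [? ?] := Sym_invfunP s; exists (Sym_fun s). Qed.

Definition Sym_one : Sym T := mk_Sym id_bij.
Definition Sym_mul s t : Sym T := mk_Sym (bij_comp (Sym_bij s) (Sym_bij t)).
Definition Sym_inv s : Sym T := mk_Sym (Sym_invfun_bij s).

Lemma Sym_mulA : associative Sym_mul.
Proof. by move=> s t u; exact: Sym_funK. Qed.

Lemma Sym_mul1s : left_id Sym_one Sym_mul.
Proof. by move=> s; exact: Sym_funK. Qed.

Lemma Sym_muls1 : right_id Sym_one Sym_mul.
Proof. by move=> s; exact: Sym_funK. Qed.

Lemma Sym_mulVs : left_inverse Sym_one Sym_inv Sym_mul.
Proof. by move=> s; apply: Sym_funK => x; exact: (Sym_invfunP s).1. Qed.

Lemma Sym_mulsV : right_inverse Sym_one Sym_inv Sym_mul.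
Proof. by move=> s; apply: Sym_funK => x; exact: (Sym_invfunP s).2. Qed.

HB.instance Definition _ := isGroup.Build (Sym T)
  Sym_mulA Sym_mul1s Sym_muls1 Sym_mulVs Sym_mulsV.

End SymGroup.

(* [n : option nat] encodes a cardinal [n <= oo], with [None] for [oo]. *)
Definition below (n : option nat) (m : nat) : bool :=
  if n is Some k then (m < k)%N else true.

Definition at_least3 (n : option nat) : bool :=
  if n is Some k then (3 <= k)%N else true.

Definition color (n : option nat) : Type := {m : nat | below n m}.

Section Homeomorphism.
Variables X Y : topologicalType.

Definition homeomorphism (f : X -> Y) : Prop :=
  continuous f /\
  exists g : Y -> X, [/\ continuous g, cancel f g & cancel g f].

Definition homeomorphic : Prop := exists f, homeomorphism f.
End Homeomorphism.

Definition locally_connected (X : topologicalType) : Prop :=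
  forall (x : X) (U : set X), nbhs x U ->
    exists V : set X, [/\ open V, V x, V `<=` U & connected V].

Definition metrizable (R : realType) (X : topologicalType) : Prop :=
  exists M : metricType R, homeomorphic X M.

Definition unit_circle (R : realType) : set (R * R)%type :=
  [set p | p.1 ^+ 2 + p.2 ^+ 2 = 1].

Definition simple_closed_curve (R : realType) (X : topologicalType)
    (A : set X) : Prop :=
  homeomorphic (set_type (@unit_circle R)) (set_type A).

Definition continuum (R : realType) (X : topologicalType) : Prop :=
  [/\ [set: X] !=set0, compact [set: X], connected [set: X] & metrizable R X].

Definition dendrite (R : realType) (X : topologicalType) : Prop :=
  [/\ continuum R X, locally_connected X &
      forall A : set X, ~ simple_closed_curve R A].

Definition is_arc (R : realType) (X : topologicalType) (x y : X)
    (A : set X) : Prop :=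
  exists f : set_type (`[0, 1]%classic : set R) -> set_type A,
    [/\ homeomorphism f,
        forall t, set_val t = 0 -> set_val (f t) = x &
        forall t, set_val t = 1 -> set_val (f t) = y].

(* Meaningful when there is exactly one arc joining [x] to [y], as is the case
   for distinct points of a dendrite. *)
Definition the_arc (R : realType) (X : topologicalType) (x y : X) : set X :=
  xget set0 [set A | is_arc R x y A].

Definition open_arc (R : realType) (X : topologicalType) (x y : X) : set X :=
  the_arc R x y `\` [set x; y].

Section Branches.
Variable X : topologicalType.

(* the component of [X \ {x}] containing [y], for [y <> x] *)
Definition component_at (x y : X) : set X :=
  connected_component (~` [set x]) y.

Definition components (x : X) : set (set X) :=
  [set component_at x y | y in ~` [set x]].

Definition Br : set X := [set x | ([set: 'I_3] #<= components x)%card].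
End Branches.

Definition wazewski_dendrite (R : realType) (n : option nat)
    (X : topologicalType) : Prop :=
  [/\ dendrite R X,
      exists x y : X, x <> y,
      forall x : X, Br x -> (components x #= [set: color n])%card &
      forall x y : X, x <> y -> (open_arc R x y `&` @Br X) !=set0].

Section Kaleidoscopic.
Variables (R : realType) (n : option nat) (X : topologicalType).

(* Only the values [c x C] with [x] a branch point and [C] a component of
   [X \ {x}] are relevant. *)
Definition coloring (c : X -> set X -> color n) : Prop :=
  forall x, Br x -> set_bij (components x) [set: color n] (c x).

Definition kaleidoscopic (c : X -> set X -> color n) : Prop :=
  coloring c /\
  forall x y, Br x -> Br y -> x <> y -> forall i j : color n, i <> j ->
    exists z, [/\ open_arc R x y z, Br z,
      c z (component_at z x) = i & c z (component_at z y) = j].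

Definition local_action (c : X -> set X -> color n) (g : X -> X) (x : X) :
    color n -> color n :=
  fun i => c (g x) (g @` 'pinv_(fun=> set0) (components x) (c x) i).

Definition kaleidoscopic_group (c : X -> set X -> color n)
    (Gamma : set (Sym (color n))) : set (X -> X) :=
  [set g | homeomorphism g /\
    forall x, Br x ->
      exists2 s, Gamma s & Sym_fun s = local_action c g x].

(* the image of a set of self-maps of [X] under restriction to [Br] *)
Definition on_Br (K : set (X -> X)) : set (Sym (set_type (@Br X))) :=
  [set s | exists2 g, K g & forall x, set_val (Sym_fun s x) = g (set_val x)].
End Kaleidoscopic.

(* Main.v *)
(* The branch points with the colors [col x y] of the component of [X \ {x}]
   containing [y] carry all the information. (1) Distinct points of [X] are cut
   by a branch point: branch points are, by kaleidoscopy, and an arc between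
   points not cut by [w] meets a single component of [X \ {w}]. So half-spaces
   at branch points generate the topology of the compact space [X], and a
   permutation of the branch points preserving "same component" extends to a
   homeomorphism. Hence membership of [s] in [K(Gamma)] says only that at each
   [x] the map [col x y |-> col (s x) (s y)] is in [Gamma]; this is a pointwise
   closed condition if [Gamma] is closed. (2) Medians exist, so a back-and-forth
   argument gives, for each permutation [gam] of the colors, an [s] fixing a
   given [x0] with local action [gam] at [x0] and trivial local action
   elsewhere; it can be chosen so that [s y] depends only on
   [gam (col x0 y)] and [y]. Thus [gam |-> s] is continuous and pulls [K(Gamma)]
   back to [Gamma]. *)
Require Import Defs.
From HB Require Import structures.
From mathcomp Require Import all_boot all_order all_algebra.
From mathcomp Require Import all_classical all_reals all_analysis.
Set Implicit Arguments.
Unset Strict Implicit.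
Unset Printing Implicit Defensive.
Import Order.TTheory GRing.Theory Num.Theory.
Import numFieldNormedType.Exports.
Local Open Scope classical_set_scope.

(** * Back-and-forth between colored trees *)

Section Trees.
Variables (C : eqType) (B : choiceType).
Implicit Types (col : B -> B -> C).

(* [col x y] plays the role of the color of the component at [x] containing [y];
   [col x x] is irrelevant. *)
Definition separates col (w x y : B) : bool :=
  [&& w != x, w != y & col w x != col w y].

(** What the back-and-forth needs to know of a colored dendrite. All rules of betweenness below come
    from [color_opp]; kaleidoscopy and surjectivity provide the images of new points. *)
Record color_tree col : Prop := ColorTree {
  color_opp : forall a b c, a != b -> a != c -> col a b != col a c ->
    col b a = col b c;
  color_median : forall x y z, x != y -> y != z -> x != z ->
    ~~ separates col x y z -> ~~ separates col y x z ->
    ~~ separates col z x y ->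
    exists m, [&& separates col m x y, separates col m y z
                & separates col m x z];
  color_kaleidoscopic : forall x y i j, x != y -> i != j ->
    exists z, [/\ z != x, z != y, col z x = i & col z y = j];
  color_surj : forall x i, exists2 y, y != x & col x y = i;
  color_other : forall i : C, exists j, j != i }.

Lemma separatesC col w x y : separates col w x y = separates col w y x.
Proof. by rewrite /separates andbCA (eq_sym (col w x)). Qed.

Section Tree.
Variable col : B -> B -> C.
Hypothesis colT : color_tree col.
Local Notation sep := (separates col).

Lemma separates_neq w x y : sep w x y -> x != y.
Proof. by case/and3P=> _ _; apply: contraNneq => ->. Qed.

Lemma separates_color w x y : sep w x y -> col x w = col x y.
Proof. by case/and3P => wx wy; exact: (color_opp colT). Qed.

(** If the color of [w] at [m] differed from both, [color_opp] would give [x] and [y] at [w] the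
    color of [m], hence equal colors. *)
Lemma separates_color_or w x y m : sep w x y -> m != w -> m != x -> m != y ->
  col m w = col m x \/ col m w = col m y.
Proof.
case/and3P=> wx wy ne mw mx my.
have [e|nx] := eqVneq (col m w) (col m x); first by left.
have [e|ny] := eqVneq (col m w) (col m y); first by right.
have := color_opp colT mw mx nx; have := color_opp colT mw my ny.
by move=> e1 e2; rewrite -e1 -e2 eqxx in ne.
Qed.

Lemma separates_trans_color w x y m : sep w x y -> m != w -> m != x ->
  m != y -> col m x = col m y -> col m w = col m x.
Proof. by move=> s mw mx my e; have [|->] := separates_color_or s mw mx my. Qed.

Lemma separates_or w x y u : sep w x y -> u != w -> sep w x u \/ sep w u y.
Proof.
case/and3P=> wx wy ne uw; rewrite /separates wx wy (eq_sym w) uw /=.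
have [<-|] := eqVneq (col w x) (col w u); last by left.
by right.
Qed.

(** If [x] and [y] had one color at [v], the point [u] between them would have it too, although [v]
    separates [u] from [x]. *)
Lemma separates_nest u v x y : sep u x y -> sep v x u -> sep v x y.
Proof.
move=> sxy svu; have /and3P[vx vu ne] := svu; have /and3P[ux uy ne'] := sxy.
have euv := separates_color svu; rewrite separatesC in svu.
have uv := separates_color svu.
have vy : v != y by apply: contraNneq ne' => <-; rewrite uv.
rewrite /separates vx vy /=; apply: contraNneq ne => e.
apply/eqP/esym; apply: (separates_trans_color sxy) => //.
Qed.

(** At [m] at most one of the three points has the color of [n]. By [color_opp] the other two have
    at [n] the color of [m], so [n] does not separate them. *)
Lemma median_uniq x y z m n : sep m x y -> sep m y z -> sep m x z ->
  sep n x y -> sep n y z -> sep n x z -> m = n.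
Proof.
move=> m1 m2 m3 n1 n2 n3; apply: contrapT => /eqP mn.
have nm : n != m by rewrite eq_sym.
have [/and3P[mx my nxy] /and3P[_ mz nyz] /and3P[_ _ nxz]] := And3 m1 m2 m3.
have [/and3P[nx ny kxy] /and3P[_ nz kyz] /and3P[_ _ kxz]] := And3 n1 n2 n3.
have h p : m != p -> col m n != col m p -> col n m = col n p.
  by move=> mp; apply: (color_opp colT).
have [ex|/(h _ mx) hx] := eqVneq (col m n) (col m x).
  rewrite -ex in nxy nxz.
  have := h _ my nxy; rewrite (h _ mz nxz) => e.
  by rewrite e eqxx in kyz.
have [ey|/(h _ my) hy] := eqVneq (col m n) (col m y).
  rewrite -ey in nyz; have := h _ mz nyz; rewrite hx => e.
  by rewrite e eqxx in kxz.
by rewrite -hx -hy eqxx in kxy.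
Qed.

End Tree.
End Trees.

(** * Extending finite partial isomorphisms by one point *)

Section BackForth.
Variables (C : eqType) (B B' : choiceType).
Variables (col : B -> B -> C) (col' : B' -> B' -> C).
Hypotheses (colT : color_tree col) (colT' : color_tree col').
Local Notation sep := (separates col).
Local Notation sep' := (separates col').
Implicit Types R : seq (B * B').

Definition color_compat (p q : B * B') : Prop :=
  (p.1 == q.1) = (p.2 == q.2) /\ (p.1 != q.1 -> col' p.2 q.2 = col p.1 q.1).

(** The domain is closed under medians so that a new point has a definite position: between two
    adjacent points of the domain, or hanging off a single one. *)
Definition partial_iso R : Prop :=
  (forall p q, p \in R -> q \in R -> color_compat p q) /\
  (forall x y z m, x \in unzip1 R -> y \in unzip1 R -> z \in unzip1 R ->
     sep m x y -> sep m y z -> sep m x z -> m \in unzip1 R).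

Lemma unzip1P R x : reflect (exists x', (x, x') \in R) (x \in unzip1 R).
Proof.
apply: (iffP mapP) => [[[a b] abR /= ->]|[x' xR]]; first by exists b.
by exists (x, x').
Qed.

Lemma partial_iso_neq R x y x' y' : partial_iso R -> (x, x') \in R ->
  (y, y') \in R -> (x' == y') = (x == y).
Proof. by move=> [h _] xR yR; have [/= ->] := h _ _ xR yR. Qed.

Lemma partial_iso_color R x y x' y' : partial_iso R -> (x, x') \in R ->
  (y, y') \in R -> x != y -> col' x' y' = col x y.
Proof. by move=> [h _] xR yR; have [_ /=] := h _ _ xR yR. Qed.

Lemma partial_iso_sep R x y z x' y' z' : partial_iso R -> (x, x') \in R ->
  (y, y') \in R -> (z, z') \in R -> sep' x' y' z' = sep x y z.
Proof.
move=> Rh xR yR zR; rewrite /separates 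
  (partial_iso_neq Rh xR yR) (partial_iso_neq Rh xR zR).
have [//|xy] := eqVneq x y; have [//|xz] := eqVneq x z.
by rewrite (partial_iso_color Rh xR yR xy) (partial_iso_color Rh xR zR xz).
Qed.

Lemma partial_iso_cons R z z' : partial_iso R -> z \notin unzip1 R ->
  (forall u u', (u, u') \in R ->
     [/\ u' != z', col' z' u' = col z u & col' u' z' = col u z]) ->
  (forall u v m, u \in unzip1 R -> v \in unzip1 R ->
     sep m z u -> sep m z v -> sep m u v -> m \in unzip1 R) ->
  partial_iso ((z, z') :: R).
Proof.
move=> [Rc Rm] zR hz hm; split.
  have neqz u u' : (u, u') \in R -> u != z.
    by move=> uR; apply: contraNneq zR => <-; apply/unzip1P; exists u'.
  move=> [p p'] [q q']; rewrite !inE.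
  case/predU1P => [[-> ->]|pR] /predU1P[[-> ->]|qR].
  - by split; rewrite /= ?eqxx.
  - have [q'z e _] := hz _ _ qR; split => //=.
    by rewrite eq_sym (negPf (neqz _ _ qR)) eq_sym (negPf q'z).
  - have [p'z _ e] := hz _ _ pR; split => //=.
    by rewrite (negPf (neqz _ _ pR)) (negPf p'z).
  - exact: Rc.
have sepnn m a : sep m a a = false by rewrite /separates eqxx !andbF.
move=> x y w m; rewrite /= !inE.
case/predU1P => [->|xR] /predU1P[->|yR] /predU1P[->|wR]; rewrite ?sepnn //.
- by move=> s1 s2 s3; rewrite (hm y w) ?orbT.
- by move=> s1 s2 s3; rewrite (hm x w) ?orbT // separatesC.
- by move=> s1 s2 s3; rewrite (hm y x) ?orbT // separatesC.
- by move=> s1 s2 s3; rewrite (Rm x y w) ?orbT.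
Qed.

Lemma count_lt (T : eqType) (P Q : pred T) (s : seq T) a :
  (forall u, u \in s -> P u -> Q u) -> a \in s -> Q a -> ~~ P a ->
  (count P s < count Q s)%N.
Proof.
elim: s => // b s IHs PQ; rewrite inE /=.
have le : (P b <= Q b)%N by have := PQ b (mem_head _ _); case: (P b) => // ->.
have le' : (count P s <= count Q s)%N.
  rewrite (@eq_in_count _ _ (predI P Q)); first by apply: sub_count => u /andP[].
  move=> u us /=; case Pu: (P u) => //=.
  by rewrite PQ // inE us orbT.
case/predU1P=> [->|as_] Qa Pa; first by rewrite Qa (negPf Pa) add0n add1n ltnS.
rewrite -addnS leq_add // IHs // => u us; apply: PQ; rewrite inE us orbT //.
Qed.

(** As long as some [u] of [s] lies between [x] and [y], the pair can be replaced by [x], [u] or by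
    [u], [y], whichever [z] still separates; fewer points of [s] then lie in between. *)
Lemma separated_edge (s : seq B) x y z : z \notin s -> x \in s -> y \in s ->
  sep z x y -> exists x1 y1, [/\ x1 \in s, y1 \in s, sep z x1 y1 &
    forall u, u \in s -> ~~ sep u x1 y1].
Proof.
move=> zs; have [n] := ubnP (count (fun u => sep u x y) s).
elim: n x y => // n IHn x y cn xs ys sz.
have [/hasP[u us su]|/hasPn nu] := boolP (has (fun u => sep u x y) s); last first.
  by exists x, y.
have uz : u != z by apply: contraNneq zs => <-.
have lt x1 y1 : (forall v, sep v x1 y1 -> sep v x y) -> ~~ sep u x1 y1 ->
    (count (fun v => sep v x1 y1) s < n)%N.
  move=> h nu; apply: leq_trans (_ : count (fun v => sep v x y) s <= n)%N => //.
  by apply: (@count_lt _ _ _ _ u) => // v _; apply: h.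
have [zxu|zuy] := separates_or sz uz.
  apply: (IHn x u) => //; apply: lt.
    by move=> v; apply: (separates_nest colT).
  by rewrite /separates eqxx andbF.
apply: (IHn u y) => //; apply: lt; last by rewrite /separates eqxx.
by move=> v; rewrite separatesC (separatesC _ _ x); apply: (separates_nest colT); rewrite separatesC.
Qed.

(** After shrinking to adjacent [x] and [y], kaleidoscopy in the target gives [z'] between their
    images with the two required colors. Betweenness then determines all colors between [z] and the
    rest of the domain, on both sides alike. *)
Lemma partial_iso_between R x y z : partial_iso R -> z \notin unzip1 R ->
  x \in unzip1 R -> y \in unzip1 R -> sep z x y ->
  exists z', partial_iso ((z, z') :: R).
Proof.
move=> Rh zR xR0 yR0 sz0.
have [x1 [y1 [/unzip1P[x' xR] /unzip1P[y' yR] sz edge]]] :=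
  separated_edge zR xR0 yR0 sz0.
move: x1 y1 xR yR sz edge {x y xR0 yR0 sz0} => x y xR yR sz edge.
have xy := separates_neq sz.
have xy' : x' != y' by rewrite (partial_iso_neq Rh xR yR).
have /and3P[zx zy nz] := sz.
have [z' [zx' zy' ex ey]] := color_kaleidoscopic colT' xy' nz.
have sz' : sep' z' x' y' by rewrite /separates zx' zy' ex ey.
have dom u u' : (u, u') \in R -> u \in unzip1 R by move=> uR; apply/unzip1P; exists u'.
exists z'; apply: partial_iso_cons => //.
- move=> u u' uR.
  have Euv v v' := @partial_iso_color R u v u' v' Rh uR.
  have uz : u != z by apply: contraNneq zR => <-; exact: dom uR.
  have nsu := edge _ (dom _ _ uR).
  have nsu' : ~~ sep' u' x' y' by rewrite (partial_iso_sep Rh uR xR yR).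
  have uz' : u' != z' by apply: contraNneq nsu' => ->.
  have [ux|ux] := eqVneq u x.
    subst u; have eu : x' = u' by apply/eqP; rewrite (partial_iso_neq Rh xR uR).
    subst u'; split => //.
    by rewrite (separates_color colT' sz') (separates_color colT sz) (Euv _ _ yR).
  have ux' : u' != x' by rewrite (partial_iso_neq Rh uR xR).
  have [uy|uy] := eqVneq u y.
    subst u; have eu : y' = u' by apply/eqP; rewrite (partial_iso_neq Rh yR uR).
    subst u'; split => //.
    rewrite separatesC in sz; rewrite separatesC in sz'.
    by rewrite (separates_color colT' sz') (separates_color colT sz) (Euv _ _ xR).
  have uy' : u' != y' by rewrite (partial_iso_neq Rh uR yR).
  have eu : col u x = col u y by apply/eqP; move: nsu; rewrite /separates ux uy negbK.
  have eu' : col' u' x' = col' u' y' by rewrite (Euv _ _ xR ux) (Euv _ _ yR uy).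
  have e := separates_trans_color colT sz uz ux uy eu.
  have e' := separates_trans_color colT' sz' uz' ux' uy' eu'.
  split => //; last by rewrite e e' (Euv _ _ xR ux).
  have zu : z != u by rewrite eq_sym.
  have zu' : z' != u' by rewrite eq_sym.
  have [xu yu xu' yu'] : [/\ x != u, y != u, x' != u' & y' != u'].
    by rewrite !(eq_sym _ u) !(eq_sym _ u').
  (* If [a] separates [b] from [u], it also separates [z] from [u], so [u] has at [z] the color of
     [a]. *)
  have aux a b a' b' : (a, a') \in R -> (b, b') \in R -> a != u -> sep z a b ->
      sep' z' a' b' -> a != b -> col' z' a' = col z a -> sep a b u ->
      col' z' u' = col z u.
    move=> aR bR au sa sa' ab eza /and3P[_ _ nab].
    have [za _ _] := and3P sa; have [za' _ _] := and3P sa'.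
    have au' : a' != u' by rewrite (partial_iso_neq Rh aR uR).
    have az : a != z by rewrite eq_sym.
    have az' : a' != z' by rewrite eq_sym.
    rewrite -(color_opp colT' az' au') -?(color_opp colT az au) //.
      by rewrite (separates_color colT sa).
    rewrite (separates_color colT' sa') (partial_iso_color Rh aR bR ab).
    by rewrite (partial_iso_color Rh aR uR au).
  have [sx|nsx] := boolP (sep x y u); first exact: (aux x y x' y').
  have [sy|nsy] := boolP (sep y x u).
    apply: (aux y x y' x') => //; rewrite 1?separatesC //.
    by rewrite eq_sym.
  (* Otherwise the median of [x], [y] and [u] would be a point of the domain between the adjacent
     points [x] and [y]. *)
  have [m /and3P[m1 m2 m3]] := color_median colT xy yu xu nsx nsy nsu.
  have mR : m \in unzip1 R.
    by apply: (Rh.2 x y u) => //; [exact: dom xR|exact: dom yR|exact: dom uR].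
  by have := edge _ mR; rewrite m1.
- move=> u v m uR vR m1 m2 m3.
  have /and3P[mz _ _] := m1.
  have [->|mx] := eqVneq m x; first exact: dom xR.
  have [->|my] := eqVneq m y; first exact: dom yR.
  (* Seen from [m], the point [z] has the color of [x] or of [y], which can replace it in the triple
     with median [m]. *)
  have aux a : a \in unzip1 R -> m != a -> col m z = col m a -> m \in unzip1 R.
    move=> aR ma e; apply: (Rh.2 a u v) => //.
      by case/and3P: m1 => _ mu ne; rewrite /separates ma mu -e.
    by case/and3P: m2 => _ mu ne; rewrite /separates ma mu -e.
  by have [/aux|/aux] := separates_color_or colT sz mz mx my; apply=> //;
    [exact: dom xR|exact: dom yR].
Qed.

(** Every other point of the domain sees [z] beyond [x], so only the colors of [x] and [z] at each
    other have to be matched. *)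
Lemma partial_iso_gate R x z : partial_iso R -> z \notin unzip1 R ->
  x \in unzip1 R ->
  (forall u, u \in unzip1 R -> u != x -> col x u != col x z) ->
  (forall u v, u \in unzip1 R -> v \in unzip1 R -> ~~ sep z u v) ->
  exists z', partial_iso ((z, z') :: R).
Proof.
move=> Rh zR /unzip1P[x' xR] gate nsz.
have dom u u' : (u, u') \in R -> u \in unzip1 R.
  by move=> uR; apply/unzip1P; exists u'.
have neqz u : u \in unzip1 R -> u != z by apply: contraTneq => ->.
have xz := neqz _ (dom _ _ xR); have zx : z != x by rewrite eq_sym.
(* [y'] fixes the color at [x']; a point [z'] between [x'] and [y'] keeps it and can receive the
   required color towards [x']. The color [j] towards [y'] only has to differ from that one. *)
have [y' yx' ey] := color_surj colT' x' (col x z).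
have [j jk] := color_other colT' (col z x).
have [z' [zx' zy' ex ej]] : exists z', [/\ z' != x', z' != y',
    col' z' x' = col z x & col' z' y' = j].
  by apply: (color_kaleidoscopic colT'); rewrite eq_sym.
have exz : col' x' z' = col x z.
  rewrite -ey; apply: (separates_color colT').
  by rewrite /separates zx' zy' ex ej eq_sym.
have xz' : x' != z' by rewrite eq_sym.
exists z'; apply: partial_iso_cons => //.
- move=> u u' uR; have uD := dom _ _ uR.
  have [ux|ux] := eqVneq u x.
    subst u; have eu : x' = u' by apply/eqP; rewrite (partial_iso_neq Rh xR uR).
    by subst u'.
  have xu : x != u by rewrite eq_sym.
  have xu' : x' != u' by rewrite (partial_iso_neq Rh xR uR).
  have ne := gate _ uD ux.
  have ne' : col' x' u' != col' x' z' by rewrite exz (partial_iso_color Rh xR uR).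
  have uz' : u' != z' by apply: contraNneq ne' => ->.
  split => //.
  + rewrite -(color_opp colT' xz' xu') 1?eq_sym //.
    by rewrite -(color_opp colT xz xu) 1?eq_sym.
  + rewrite -(color_opp colT' xu' xz') // -(color_opp colT xu xz) //.
    by rewrite (partial_iso_color Rh uR xR).
- move=> u v m uR vR m1 m2 m3.
  have [->|mx] := eqVneq m x; first exact: dom xR.
  have [/and3P[mz mu nu] /and3P[_ mv nv] /and3P[_ _ nuv]] := And3 m1 m2 m3.
  have [e|ne] := eqVneq (col m x) (col m z).
    apply: (Rh.2 x u v) => //; first exact: dom xR.
      by rewrite /separates mx mu e.
    by rewrite /separates mx mv e.
  have ez := color_opp colT mx mz ne.
  have aux a : a \in unzip1 R -> m != a -> col m x != col m a -> m \in unzip1 R.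
    move=> aR ma na; have ea := color_opp colT mx ma na.
    have ax : a != x by apply: contraNneq na => ->.
    by have := gate _ aR ax; rewrite -ea ez eqxx.
  have [e|] := eqVneq (col m x) (col m u); last exact: aux.
  by apply: (aux v) => //; rewrite e.
Qed.

(** Descent on a base point [x], counting the points of the domain in its direction towards [z]. If
    there are none and [z] separates no two points of the domain, [x] is a gate; otherwise the base
    point moves towards [z]. *)
Lemma partial_iso_forth R z : partial_iso R -> R != [::] ->
  exists R', [/\ partial_iso R', {subset R <= R'} & z \in unzip1 R'].
Proof.
case: R => // -[x x'] R Rh _; have : x \in unzip1 ((x, x') :: R) by rewrite mem_head.
move: Rh; move: {x' R}(_ :: R) => R.
have [n] := ubnP (count (fun u => (u != x) && (col x u == col x z)) (unzip1 R)).
elim: n R x => // n IHn R x cn Rh xR.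
have [zR|zR] := boolP (z \in unzip1 R); first by exists R; split.
have neqz u : u \in unzip1 R -> u != z by apply: contraTneq => ->.
have step z' : partial_iso ((z, z') :: R) ->
    exists R', [/\ partial_iso R', {subset R <= R'} & z \in unzip1 R'].
  move=> h; exists ((z, z') :: R); split => //; last by rewrite mem_head.
  by move=> p pR; rewrite inE pR orbT.
have [[u [v [uR vR s]]]|nsz] := pselect (exists u v,
    [/\ u \in unzip1 R, v \in unzip1 R & sep z u v]).
  by have [z'] := partial_iso_between Rh zR uR vR s; exact: step.
have {}nsz u v : u \in unzip1 R -> v \in unzip1 R -> ~~ sep z u v.
  by move=> uR vR; apply/negP => s; apply: nsz; exists u, v.
have [[y [yR yx ey]]|ngate] := pselect (exists y,
    [/\ y \in unzip1 R, y != x & col x y = col x z]); last first.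
  have [u uR ux|z'] := partial_iso_gate Rh zR xR _ nsz; last exact: step.
  by apply/eqP => e; apply: ngate; exists u.
have xy : x != y by rewrite eq_sym.
have [yz xz] := (neqz _ yR, neqz _ xR); have zx : z != x by rewrite eq_sym.
(* A point [w] between [x] and [z] with fewer obstructions than [x]. *)
suff [w [R' [R'h sR' wR' sw yw]]] : exists w R', [/\ partial_iso R',
    R' = R \/ exists w', R' = (w, w') :: R,
    w \in unzip1 R', sep w x z & (w == y) || sep w y z].
  have /and3P[wx wz nw] := sw.
  have cw : col x w = col x z.
    exact: (separates_color colT).
  have RR' : {subset R <= R'}.
    by case: sR' => [->|[w' ->]] // p pR; rewrite inE pR orbT.
  have [|R'' [R''h sR'' zR'']] := IHn R' w _ R'h wR'; last first.
    by exists R''; split=> // p /RR' /sR''.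
  rewrite -ltnS; apply: leq_trans cn; rewrite ltnS.
  (* A newly added [w] is the new base point, hence is not counted. *)
  set P' := (fun u => _); have {sR'} -> : count P' (unzip1 R') = count P' (unzip1 R).
    by case: sR' => [->|[w' ->]] //=; rewrite /P' eqxx.
  apply: (@count_lt _ _ _ _ y) => //; last 2 first.
  - by rewrite yx ey eqxx.
  - case/predU1P: yw => [e|/and3P[_ _ ny]]; first by rewrite /P' e eqxx.
    by rewrite /P' negb_and ny orbT.
  move=> u uR /andP[uw /eqP eu].
  have ux : u != x by apply: contraNneq nw => <-; rewrite eu.
  have wu : w != u by rewrite eq_sym.
  by rewrite ux -cw (color_opp colT wx wu) ?eu ?eqxx.
have [s|nsy] := boolP (sep y x z).
  by exists y, R; rewrite eqxx; split=> //; left.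
have nsx : ~~ sep x y z by rewrite /separates ey eqxx !andbF.
have [w /and3P[w1 w2 w3]] := color_median colT xy yz xz nsx nsy (nsz _ _ xR yR).
have [wR|wR] := boolP (w \in unzip1 R).
  by exists w, R; rewrite w2 orbT; split=> //; left.
have [w' h] := partial_iso_between Rh wR xR yR w1.
exists w, ((w, w') :: R); split => //; rewrite ?w2 ?orbT ?mem_head //.
by right; exists w'.
Qed.

End BackForth.

(** * Isomorphism of countable color trees *)

Section Uniqueness.
Variable C : eqType.

Definition swap_pairs (B B' : choiceType) (R : seq (B * B')) : seq (B' * B) :=
  [seq (p.2, p.1) | p <- R].

Lemma mem_swap_pairs (B B' : choiceType) (R : seq (B * B')) x x' :
  ((x', x) \in swap_pairs R) = ((x, x') \in R).
Proof.
apply/mapP/idP => [[[a b] abR /= [-> ->]] //|xR].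
by exists (x, x').
Qed.

(** For closure of the range under medians: the preimages of three points have a median in the
    domain, and its image is the given median by [median_uniq]. *)
Lemma partial_iso_swap (B B' : choiceType) (col : B -> B -> C)
    (col' : B' -> B' -> C) (R : seq (B * B')) :
  color_tree col -> color_tree col' -> partial_iso col col' R ->
  partial_iso col' col (swap_pairs R).
Proof.
move=> colT colT' Rh; split.
  move=> [p' p] [q' q]; rewrite !mem_swap_pairs => pR qR; split=> /=.
    exact: (partial_iso_neq Rh).
  by rewrite (partial_iso_neq Rh pR qR) => pq; rewrite (partial_iso_color Rh pR qR).
move=> x' y' z' m' /unzip1P[x] + /unzip1P[y] + /unzip1P[z] +.
rewrite !mem_swap_pairs => xR yR zR m1 m2 m3.
have s12 := separates_neq m1; have s23 := separates_neq m2.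
have s13 := separates_neq m3.
have nsep a b c : separates col' m' a b -> separates col' m' a c ->
    ~~ separates col' a b c.
  move=> /(separates_color colT') e1 /(separates_color colT') e2.
  by rewrite /separates -e1 e2 eqxx !andbF.
have [m /and3P[n1 n2 n3]] : exists m, [&& separates col m x y,
    separates col m y z & separates col m x z].
  apply: (color_median colT).
  - by rewrite -(partial_iso_neq Rh xR yR).
  - by rewrite -(partial_iso_neq Rh yR zR).
  - by rewrite -(partial_iso_neq Rh xR zR).
  - by rewrite -(partial_iso_sep Rh xR yR zR) nsep.
  - by rewrite -(partial_iso_sep Rh yR xR zR) nsep // separatesC.
  - by rewrite -(partial_iso_sep Rh zR xR yR) nsep // separatesC.
have dom u u' : (u, u') \in R -> u \in unzip1 R.
  by move=> uR; apply/unzip1P; exists u'.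
have := Rh.2 _ _ _ _ (dom _ _ xR) (dom _ _ yR) (dom _ _ zR) n1 n2 n3.
move=> /unzip1P[n' mR].
move: n1 n2 n3; rewrite -(partial_iso_sep Rh mR xR yR)
  -(partial_iso_sep Rh mR yR zR) -(partial_iso_sep Rh mR xR zR) => n1 n2 n3.
apply/unzip1P; exists m; rewrite mem_swap_pairs.
by rewrite (median_uniq colT' m1 m2 m3 n1 n2 n3).
Qed.

Lemma color_tree_iso (B B' : choiceType) (col : B -> B -> C)
    (col' : B' -> B' -> C) (e : nat -> B) (e' : nat -> B') x0 x0' :
  (forall x, exists n, e n = x) -> (forall x', exists n, e' n = x') ->
  color_tree col -> color_tree col' ->
  exists f : B -> B', [/\ bijective f, f x0 = x0' &
    forall x y, x != y -> col' (f x) (f y) = col x y].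
Proof.
move=> esurj esurj' colT colT'.
(* Each step adds [e n] to the domain and [e' n] to the range. The hypotheses stand under the
   existential so that [nxt] is defined on all lists. *)
have step n (R : seq (B * B')) : exists R', partial_iso col col' R ->
    R != [::] -> [/\ partial_iso col col' R', {subset R <= R'}, R' != [::],
      e n \in unzip1 R' & e' n \in unzip1 (swap_pairs R')].
  have [[Rh R0]|h] := pselect (partial_iso col col' R /\ R != [::]); last first.
    by exists R => Rh R0; case: h.
  have [R1 [R1h sR1 eR1]] := partial_iso_forth colT colT' (e n) Rh R0.
  have R10 : R1 != [::] by case: R1 eR1 {R1h sR1}.
  have R10' : swap_pairs R1 != [::] by case: R1 R10 {R1h sR1 eR1}.
  have R1h' := partial_iso_swap colT colT' R1h.
  have [R2 [R2h sR2 eR2]] := partial_iso_forth colT' colT (e' n) R1h' R10'.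
  have s12 p : p \in R1 -> p \in swap_pairs R2.
    by case: p => x y h; rewrite mem_swap_pairs; apply: sR2; rewrite mem_swap_pairs.
  exists (swap_pairs R2) => _ _; split.
  - exact: partial_iso_swap.
  - by move=> p /sR1 /s12.
  - by case: R2 eR2 {R2h sR2 s12}.
  - case/unzip1P: eR1 => x' /s12 h; apply/unzip1P; by exists x'.
  - case/unzip1P: eR2 => x h; apply/unzip1P; exists x.
    by rewrite !mem_swap_pairs.
pose nxt n R := projT1 (cid (step n R)).
have nxtP n R := projT2 (cid (step n R)); rewrite -/(nxt _ _) in nxtP.
pose S := fix S n := if n is k.+1 then nxt k (S k) else [:: (x0, x0')].
have S0 : partial_iso col col' (S 0) /\ S 0 != [::].
  split => //; split.
    by move=> p q; rewrite !inE => /eqP -> /eqP ->; split; rewrite /= ?eqxx.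
  move=> x y z m; rewrite !inE => /eqP -> /eqP ->.
  by rewrite /separates eqxx !andbF.
have SP n : partial_iso col col' (S n) /\ S n != [::].
  by elim: n => // n [h1 h2]; have [] := nxtP n _ h1 h2.
have Snxt n : [/\ {subset S n <= S n.+1}, e n \in unzip1 (S n.+1)
    & e' n \in unzip1 (swap_pairs (S n.+1))].
  by have [h1 h2] := SP n; have [] := nxtP n _ h1 h2.
have Sle m n p : (m <= n)%N -> p \in S m -> p \in S n.
  move=> /subnKC <-; elim: (n - m)%N => [|k IHk]; first by rewrite addn0.
  by move=> /IHk; rewrite addnS; have [+ _ _] := Snxt (m + k)%N; apply.
have comm p q m n : p \in S m -> q \in S n ->
    exists k, [/\ partial_iso col col' (S k), p \in S k & q \in S k].
  move=> pm qn; exists (maxn m n); split; first by have [] := SP (maxn m n).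
    exact: Sle (leq_maxl _ _) pm.
  exact: Sle (leq_maxr _ _) qn.
have ftot x : exists x', exists n, (x, x') \in S n.
  have [n <-] := esurj x; have [_ /unzip1P[x' h] _] := Snxt n.
  by exists x', n.+1.
have gtot x' : exists x, exists n, (x, x') \in S n.
  have [n <-] := esurj' x'; have [_ _ /unzip1P[x h]] := Snxt n.
  by exists x, n.+1; rewrite mem_swap_pairs in h.
pose f x := projT1 (cid (ftot x)); have fP x := projT2 (cid (ftot x)).
pose g x := projT1 (cid (gtot x)); have gP x := projT2 (cid (gtot x)).
rewrite -/(f _) in fP; rewrite -/(g _) in gP.
have fE x x' n : (x, x') \in S n -> f x = x'.
  have [m xm xn] := fP x; have [k [h p q]] := comm _ _ _ _ xm xn.
  by apply/eqP; rewrite (partial_iso_neq h p q).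
have gE x x' n : (x, x') \in S n -> g x' = x.
  have [m xm xn] := gP x'; have [k [h p q]] := comm _ _ _ _ xm xn.
  by apply/eqP; rewrite -(partial_iso_neq h p q).
exists f; split.
- exists g => [x|x']; first by have [n /gE] := fP x.
  by have [n /fE] := gP x'.
- by apply: (fE _ _ 0); rewrite /= mem_head.
move=> x y xy; have [m xm] := fP x; have [n xn] := fP y.
have [k [h p q]] := comm _ _ _ _ xm xn.
exact: partial_iso_color h p q xy.
Qed.

End Uniqueness.

(** * Permutations with prescribed local action at one point *)

Section LocalAction.
Variables (C : eqType) (B : choiceType) (col : B -> B -> C).
Hypothesis colT : color_tree col.
Implicit Types (s : C -> C) (x y : B).

(** An isomorphism from [col] to this recoloring that fixes [x0] acts on the colors at [x0] by the
    inverse of [s] and preserves all colors elsewhere. *)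
Definition recolor x0 s x y : C := if x == x0 then s (col x y) else col x y.

(** Separation only compares colors at one point, so an injective recoloring does not change it.
    Kaleidoscopy could fail only through the witness [x0], which can be avoided. *)
Lemma recolor_color_tree x0 s : bijective s -> color_tree (recolor x0 s).
Proof.
move=> sbij; have sinj := bij_inj sbij; have [s' sK s'K] := sbij.
have recE a b c : (recolor x0 s a b == recolor x0 s a c) = (col a b == col a c).
  by rewrite /recolor; case: ifP => // _; rewrite (inj_eq sinj).
have sepE w x y : separates (recolor x0 s) w x y = separates col w x y.
  by rewrite /separates recE.
have recK a i : exists j, forall b, (recolor x0 s a b == i) = (col a b == j).
  rewrite /recolor; case: eqP => _; last by exists i.
  by exists (s' i) => b; rewrite -(inj_eq (can_inj s'K)) sK.
split.
- move=> a b c ab ac; rewrite recE => /(color_opp colT ab ac) e.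
  by apply/eqP; rewrite recE e.
- by move=> x y z xy yz xz; rewrite !sepE => /(color_median colT) h /h h' /h' [] // m;
    exists m; rewrite !sepE.
- have kal x y i j z : x != y -> i != j -> z != x -> z != y -> col z x = i ->
      col z y = j -> z != x0 -> exists z,
      [/\ z != x, z != y, recolor x0 s z x = i & recolor x0 s z y = j].
    by move=> xy ij zx zy zi zj zx0; exists z; rewrite /recolor (negPf zx0).
  move=> x y i j xy ij.
  have [z [zx zy zi zj]] := color_kaleidoscopic colT xy ij.
  have [z0|] := eqVneq z x0; last exact: kal zi zj.
  (* If the witness [z] is [x0], a witness [w] for the pair [x], [z] with the same colors also
     serves for [x], [y], since [y] lies beyond [z]. *)
  have xz : x != z by rewrite eq_sym.
  have [w [wx wz wi wj]] := color_kaleidoscopic colT xz ij.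
  have sw : separates col w x z by rewrite /separates wx wz wi wj.
  have sz : separates col z x y by rewrite /separates zx zy zi zj.
  have sxy : separates col w x y by exact: (separates_nest colT sz sw).
  have /and3P[_ wy _] := sxy.
  have nzy : col z w != col z y.
    move: sw; rewrite separatesC => /(separates_color colT) ->.
    by rewrite zi zj.
  have zw : z != w by rewrite eq_sym.
  have e := color_opp colT zw zy nzy.
  by apply: (kal x y i j w) => //; [rewrite -e|rewrite -z0].
- move=> x i; have [j h] := recK x i; have [y yx e] := color_surj colT x j.
  by exists y => //; apply/eqP; rewrite h e.
- exact: (color_other colT).
Qed.

Definition local_iso x0 s (f : B -> B) : Prop :=
  [/\ bijective f, f x0 = x0,
    forall y, y != x0 -> col x0 (f y) = s (col x0 y) &
    forall x y, x != x0 -> y != x -> col (f x) (f y) = col x y].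

Section Enumerated.
Variable e : nat -> B.
Hypothesis esurj : forall x, exists n, e n = x.

Lemma local_iso_exists x0 s : bijective s -> exists f, local_iso x0 s f.
Proof.
move=> sbij; have [s' sK s'K] := sbij; have s'bij : bijective s' by exists s.
have [f [fbij f0 fc]] := color_tree_iso x0 x0 esurj esurj colT
  (recolor_color_tree x0 s'bij).
exists f; split => // [y y0|x y x0' yx].
  by have := fc x0 y; rewrite /recolor f0 eqxx eq_sym => /(_ y0) <-; rewrite s'K.
have fx : f x != x0 by rewrite -f0 (bij_eq fbij).
by have := fc x y; rewrite /recolor (negPf fx) eq_sym => /(_ yx).
Qed.

Definition swap (i j k : C) : C := if k == i then j else if k == j then i else k.

Lemma swapK i j : involutive (swap i j).
Proof.
move=> k; rewrite /swap; have [->|ki] := eqVneq k i.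
  by have [->|ji] := eqVneq j i; rewrite ?eqxx.
by have [->|kj] := eqVneq k j; rewrite ?eqxx // (negPf ki) (negPf kj).
Qed.

Lemma swap_l i j : swap i j i = j.
Proof. by rewrite /swap eqxx. Qed.

Lemma swap_r i j : swap i j j = i.
Proof. by rewrite /swap eqxx; case: eqP. Qed.

Lemma swap_bij i j : bijective (swap i j).
Proof. exact: (inv_bij (@swapK i j)). Qed.

(* The second clause is the continuity of [F] for pointwise convergence. *)
Lemma local_iso_family x0 : exists F : (C -> C) -> B -> B,
  (forall s, bijective s -> local_iso x0 s (F s)) /\
  (forall s t x, s (col x0 x) = t (col x0 x) -> F s x = F t x).
Proof.
(* Any local isomorphism carrying the component of color [i] at [x0] to that of color [j] would do;
   a transposition of colors provides one. *)
pose phi i j := projT1 (cid (local_iso_exists x0 (swap_bij i j))).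
have phiP i j : local_iso x0 (swap i j) (phi i j).
  exact: (projT2 (cid (local_iso_exists x0 (swap_bij i j)))).
(* [F s] is glued from these maps: on the component of color [i] at [x0] it is [phi i (s i)]. *)
exists (fun s x => phi (col x0 x) (s (col x0 x)) x); split; last first.
  by move=> s t x ->.
move=> s sbij; have [s' sK s'K] := sbij; have sinj := can_inj sK.
set F := (fun x => _).
have Fx0 : F x0 = x0 by rewrite /F; have [] := phiP (col x0 x0) (s (col x0 x0)).
have Fcol y : y != x0 -> col x0 (F y) = s (col x0 y).
  move=> y0; rewrite /F; have [_ _ -> // _] := phiP (col x0 y) (s (col x0 y)).
  exact: swap_l.
have Fne y : y != x0 -> F y != x0.
  move=> y0; have [b e0 _ _] := phiP (col x0 y) (s (col x0 y)).
  by rewrite /F -[X in _ != X]e0 (bij_eq b).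
split => //.
- have inv i j : {g : B -> B | cancel (phi i j) g /\ cancel g (phi i j)}.
    by apply: cid; have [[g ? ?] _ _ _] := phiP i j; exists g.
  pose g i j := projT1 (inv i j).
  have phiK i j : cancel (phi i j) (g i j) := (projT2 (inv i j)).1.
  have gK i j : cancel (g i j) (phi i j) := (projT2 (inv i j)).2.
  have gx0 i j : g i j x0 = x0.
    by have [_ e0 _ _] := phiP i j; rewrite -{1}e0 phiK.
  exists (fun y => g (s' (col x0 y)) (col x0 y) y) => [x|y].
    have [->|x0'] := eqVneq x x0; first by rewrite Fx0 gx0.
    by rewrite Fcol // sK /F phiK.
  have [->|y0] := eqVneq y x0; first by rewrite gx0.
  set x := g _ _ y; rewrite /F.
  suff -> : col x0 x = s' (col x0 y) by rewrite s'K /x gK.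
  have [_ e0 h _] := phiP (s' (col x0 y)) (col x0 y).
  have fx : phi (s' (col x0 y)) (col x0 y) x = y by rewrite gK.
  have xx0 : x != x0 by apply: contraNneq y0 => ex; rewrite -fx ex e0.
  by have := h x xx0; rewrite fx => /esym/(canRL (@swapK _ _)) ->; rewrite swap_r.
- move=> x y xx0 yx.
  have x0x : x0 != x by rewrite eq_sym.
  have [_ e1 _ h] := phiP (col x0 x) (s (col x0 x)).
  have ex0 : col (F x) x0 = col x x0 by rewrite -(h x x0) // e1.
  have [->|yx0] := eqVneq y x0; first by rewrite Fx0.
  have [exy|nxy] := eqVneq (col x0 x) (col x0 y).
    by rewrite -(h x y) // /F exy.
  (* Points in different components at [x0] see each other in the direction of [x0], and so do their
     images. *)
  have x0y : x0 != y by rewrite eq_sym.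
  rewrite -(color_opp colT x0x x0y nxy) -ex0.
  apply/esym/(color_opp colT); rewrite 1?eq_sym ?Fne //.
  by rewrite !Fcol // (inj_eq sinj) eq_sym.
Qed.

End Enumerated.
End LocalAction.

(** * Components of the complement of a point *)

Section Components.
Variable X : topologicalType.
Hypotheses (Xhaus : hausdorff_space X) (Xconn : connected [set: X])
  (Xloc : locally_connected X).
Implicit Types (x y z w p : X) (A E : set X).
Local Notation comp := (@component_at X).

Lemma component_at_refl x y : y <> x -> comp x y y.
Proof. by move=> yx; exact: connected_component_refl. Qed.

Lemma component_at_neq x y z : comp x y z -> z <> x.
Proof. by move/connected_component_sub. Qed.

Lemma component_at_eq x y z : comp x y z -> comp x y = comp x z.
Proof. exact: same_connected_component. Qed.

Lemma component_at_sym x y z : comp x y z -> comp x z y.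
Proof. exact: connected_component_sym. Qed.

Lemma component_at_max x y A : connected A -> A y -> ~ A x -> A `<=` comp x y.
Proof.
move=> Ac Ay Ax; apply: connected_component_max => // z Az /= zx.
by rewrite zx in Az.
Qed.

Lemma component_at_out x : comp x x = set0.
Proof. by apply: connected_component_out => /=; apply. Qed.

Lemma component_at_open x y : open (comp x y).
Proof.
rewrite openE => z xyz; rewrite /interior (component_at_eq xyz).
have zx := component_at_neq xyz.
have : nbhs z (~` [set x]).
  apply: open_nbhs_nbhs; split => //; apply: closed_openC.
  exact/accessible_closed_set1/hausdorff_accessible.
move=> /Xloc[V [oV Vz Vx Vc]]; apply: (@filterS _ _ _ V).
  by apply: component_at_max => // /Vx; apply.
exact: open_nbhs_nbhs.
Qed.

Lemma component_at_closure x y : closure (comp x y) `<=` x |` comp x y.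
Proof.
move=> p pC; have [->|px] := pselect (p = x); [by left|right].
have [q [xyq xpq]] : comp x y `&` comp x p !=set0.
  by apply: pC; apply: open_nbhs_nbhs; split;
    [exact: component_at_open|exact: component_at_refl].
by rewrite (component_at_eq xyq) -(component_at_eq xpq); exact: component_at_refl.
Qed.

(** If [x] were not a limit of the component, the component would be open and closed in the
    connected space. *)
Lemma component_at_limit x y : y <> x -> closure (comp x y) = x |` comp x y.
Proof.
move=> yx; apply/seteqP; split; first exact: component_at_closure.
move=> p [->|]; last exact: subset_closure.
apply: contrapT => xC; have cl : closed (comp x y).
  move=> q qC; have [qx|//] := component_at_closure qC.
  by rewrite qx in qC.
have : comp x y = setT.
  apply: Xconn; first by exists y; exact: component_at_refl.
    by exists (comp x y); rewrite ?setTI //; exact: component_at_open.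
  by exists (comp x y); rewrite ?setTI.
by move=> e; have : comp x y x by [rewrite e]; move/component_at_neq.
Qed.

(** The complement is a union of connected sets through [x], namely the other components with [x]
    adjoined. *)
Lemma component_atC_connected x y : connected (~` comp x y).
Proof.
have -> : ~` comp x y = \bigcup_(z in ~` comp x y) (x |` comp x z).
  apply/seteqP; split=> z.
    move=> nz; exists z => //; have [->|zx] := pselect (z = x); [by left|right].
    exact: component_at_refl.
  move=> [p np [->|xpz] xyz]; first by move/component_at_neq: xyz.
  by apply: np; rewrite (component_at_eq xyz); exact: component_at_sym.
apply: bigcup_connected; first by exists x => z _; left.
move=> z _; have [->|zx] := pselect (z = x).
  by rewrite component_at_out setU0; exact: connected1.
by rewrite -component_at_limit //; apply/connected_closure/component_connected.
Qed.

Lemma component_at_opp x y z : x <> y -> ~ comp x y z -> comp y x z.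
Proof.
move=> xy nz; apply: (component_at_max (@component_atC_connected x y)) => //=.
  by move/component_at_neq.
by apply; apply: component_at_refl => /esym.
Qed.

Lemma component_at_laminar w a w' b p : comp w a p -> comp w' b p ->
  [\/ comp w a `<=` comp w' b, comp w' b `<=` comp w a |
    comp w a `|` comp w' b = setT].
Proof.
move=> wap wbp; rewrite (component_at_eq wap) (component_at_eq wbp).
have [<-|ww'] := pselect (w = w'); first by apply: Or31.
have [pw|npw] := pselect (comp w' p w); last first.
  apply: Or32; apply: component_at_max => //; first exact: component_connected.
  exact/component_at_refl/(component_at_neq wbp).
have [pw'|npw'] := pselect (comp w p w'); last first.
  apply: Or31; apply: component_at_max => //; first exact: component_connected.
  exact/component_at_refl/(component_at_neq wap).
apply/Or33/seteqP; split=> // z _.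
have [?|nz] := pselect (comp w p z); [by left|right].
rewrite (component_at_eq pw); apply: component_at_opp => //.
by rewrite -(component_at_eq pw').
Qed.

(** The union [Q] of the members containing [x] is relatively clopen in [E]: a member meeting [Q] is
    nested with one containing [x], hence lies in [Q]. *)
Lemma laminar_cover E (F : set (set X)) : connected E ->
  (forall H, F H -> open H) -> E `<=` \bigcup_(H in F) H ->
  (forall H K, F H -> F K -> H `&` K !=set0 -> H `<=` K \/ K `<=` H) ->
  forall x y, E x -> E y -> exists H, [/\ F H, H x & H y].
Proof.
move=> Ec Fo EF Fl x y Ex Ey.
pose Q := \bigcup_(H in F `&` [set H | H x]) H.
pose Q' := \bigcup_(H in F `&` [set H | H `&` Q = set0]) H.
have EQ : E `&` Q = E.
  apply: Ec.
  - by exists x; split=> //; have [H FH Hx] := EF _ Ex; exists H.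
  - by exists Q => //; apply: bigcup_open => H [/Fo].
  - exists (~` Q'); first by apply: open_closedC; apply: bigcup_open => H [/Fo].
    apply/seteqP; split=> z [Ez Qz]; split=> //.
      by move=> [H [FH HQ] Hz]; have : (H `&` Q) z by []; rewrite HQ.
    have [H FH Hz] := EF _ Ez; apply: contrapT => nQz; apply: Qz.
    exists H => //; split=> //=; apply/seteqP; split=> // q [Hq [K [FK Kx] Kq]].
    have [|HK|KH] := Fl H K FH FK; first by exists q.
      by apply: nQz; exists K => //; exact: HK.
    by apply: nQz; exists H => //; split=> //; exact: KH.
move: Ey; rewrite -EQ => -[_ [H [FH Hx] Hy]].
by exists H.
Qed.

Definition cuts w x y := [/\ w <> x, w <> y & ~ comp w x y].

Hypothesis Xcut : forall x y, x <> y -> exists2 w, Br w & cuts w x y.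

(** The half-spaces at branch points that miss [x] cover the component, and no two of them cover the
    whole space, so they are laminar. This moves the vertex of a half-space off [x]. *)
Lemma component_at_engulf x y z : comp x y z ->
  exists w, [/\ Br w, w <> x, comp w y z, comp w y y & ~ comp w y x].
Proof.
move=> xyz; have xy : y <> x by apply: component_at_neq; exact: component_at_sym xyz.
pose F := [set H | exists w a, [/\ Br w, w <> x, H = comp w a & ~ H x]].
have [||||||H [[w [a [Bw wx -> nx]]] ay az]] :=
    @laminar_cover (comp x y) F _ _ _ _ y z.
- exact: component_connected.
- by move=> _ [w [a [_ _ -> _]]]; exact: component_at_open.
- move=> p /component_at_neq xp; have [w Bw [wx wp nxp]] := Xcut xp.
  exists (comp w p); last by apply: component_at_refl => /esym.
  by exists w, p; split=> //; apply.
- move=> _ _ [w [a [Bw wx -> nx]]] [w' [a' [Bw' wx' -> nx']]] [p [ap ap']].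
  have [?|?|e] := component_at_laminar ap ap'; [by left|by right|].
  by have : setT x by []; rewrite -e => -[].
- exact: component_at_refl.
- exact: xyz.
exists w; rewrite -(component_at_eq ay); split=> //.
Qed.

(** Two half-spaces with at most one of the three points each cannot cover the space, so such
    half-spaces are laminar. If they covered the space, one would contain both [x] and [y]. A point
    outside all of them is the median. *)
Lemma median_exists x y z : x <> y -> y <> z -> x <> z ->
  ~ cuts x y z -> ~ cuts y x z -> ~ cuts z x y ->
  exists m, [/\ cuts m x y, cuts m y z & cuts m x z].
Proof.
move=> xy yz xz nx ny nz.
pose F := [set H | exists w a, [/\ H = comp w a, ~ (H x /\ H y), ~ (H y /\ H z)
  & ~ (H x /\ H z)]].
have [m nm] : exists m, ~ (\bigcup_(H in F) H) m.
  apply: contrapT => /forallNP h.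
  have [|||||H [[w [a [_ n _ _]]] Hx Hy]] := @laminar_cover setT F Xconn _ _ _ x y => //.
  - by move=> _ [w [a [-> _ _ _]]]; exact: component_at_open.
  - by move=> p _; apply: contrapT; exact: h.
  - move=> _ _ [w [a [-> n1 n2 n3]]] [w' [a' [-> n1' n2' n3']]] [p [ap ap']].
    have [?|?|e] := component_at_laminar ap ap'; [by left|by right|].
    have c q : comp w a q \/ comp w' a' q by have : setT q by []; rewrite -e.
    by case: (c x) (c y) (c z) => [?|?] [?|?] [?|?]; tauto.
  by case: n.
(* If two of the points lie in one component at [p], engulfing them gives a vertex [w] whose
   half-space around [p] misses both, so it belongs to [F]. *)
have key p : [\/ comp p x y, comp p y z | comp p x z] -> m <> p.
  move=> h; suff [w [wp]] : exists w, w <> p /\ F (comp w p).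
    by move=> Fw mp; apply: nm; exists (comp w p); rewrite ?mp //;
      apply: component_at_refl => /esym.
  have far q r : comp p q r -> exists w, [/\ w <> p, ~ comp w p q & ~ comp w p r].
    move=> /component_at_engulf[w [_ wp qr _ qp]]; exists w; split => //.
      by move/component_at_sym.
    by move=> pr; apply: qp; rewrite (component_at_eq qr); exact: component_at_sym.
  by case: h => /far[w [wp nq nr]]; exists w; split=> //; exists w, p;
    split=> // -[].
have cutsC w a b : w <> a -> w <> b -> ~ cuts w a b -> comp w a b.
  by move=> wa wb n; apply: contrapT => nab; apply: n.
have mx : m <> x by apply: key; apply: Or32; exact: cutsC.
have my : m <> y by apply: key; apply: Or33; apply: cutsC => // /esym.
have mz : m <> z by apply: key; apply: Or31; apply: cutsC => // /esym.
exists m; split; split=> // h; apply: (key m) => //.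
- exact: Or31.
- exact: Or32.
- exact: Or33.
Qed.
End Components.

(** * Density and countability of the branch points *)

Lemma enum_of_inj (B : Type) (T : countType) (code : B -> T) (b0 : B) :
  injective code -> exists e : nat -> B, forall b, exists n, e n = b.
Proof.
move=> inj; pose e k := if pselect (exists b, pickle (code b) = k) is left h
  then projT1 (cid h) else b0.
exists e => b; exists (pickle (code b)); rewrite /e.
case: pselect => [h|]; last by case; exists b.
by apply/inj/(pcan_inj pickleK); exact: (projT2 (cid h)).
Qed.

Lemma compact_metrizable_dense (R : realType) (X : topologicalType) :
  compact [set: X] -> metrizable R X ->
  exists D : set X, countable D /\ dense D.
Proof.
move=> Xcomp [M [f [fc [g [gc fK gK]]]]].
have [[x0]|/nonemptyPn X0] := pselect ([set: X] !=set0); last first.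
  by exists set0; split=> // U [x]; have : setT x by []; rewrite X0.
pose M' : pseudoPMetricType R := HB.pack M (isPointed.Build M (f x0)).
have Mcomp : compact [set: M'].
  have -> : [set: M'] = f @` setT.
    by apply/seteqP; split=> // m _; exists (g m).
  by apply: continuous_compact => //; exact: continuous_subspaceT.
have [Bs Bcount [Bopen Bbase]] := compact_second_countable Mcomp.
exists ((fun U => g (xget (f x0) U)) @` Bs); split.
  exact: sub_countable (card_image_le _ _) Bcount.
move=> U [x Ux] Uo.
have : nbhs (f x) (g @^-1` U).
  by apply: gc; rewrite fK; apply: open_nbhs_nbhs.
move=> /Bbase.
move=> [V [BV Vx] VU]; exists (g (xget (f x0) V)); split; last by exists V.
by apply: VU; exact: (xgetI _ Vx).
Qed.

Section BranchPoints.
Variable X : topologicalType.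
Hypotheses (Xhaus : hausdorff_space X) (Xconn : connected [set: X])
  (Xloc : locally_connected X).
Implicit Types x y z w p : X.
Local Notation comp := (@component_at X).

Lemma cuts3_Br m x y z : cuts m x y -> cuts m y z -> cuts m x z -> Br m.
Proof.
move=> [mx my nxy] [_ mz nyz] [_ _ nxz]; rewrite /Br /=.
pose D (i : 'I_3) : set X := nth set0 [:: comp m x; comp m y; comp m z] i.
have neq a b : m <> b -> ~ comp m a b -> comp m a <> comp m b.
  by move=> mb nab e; apply: nab; rewrite e; apply: component_at_refl => /esym.
have Dinj : {in [set: 'I_3] &, injective D}.
  move=> i j _ _ /eqP; rewrite nth_uniq //; first by move/eqP/val_inj.
  rewrite !cons_uniq !inE !negb_or !andbT -andbA.
  have [exy exz eyz] := And3 (neq _ _ my nxy) (neq _ _ mz nxz) (neq _ _ mz nyz).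
  by apply/and3P; split; case: pselect.
apply: card_le_trans (_ : (D @` setT #<= _)%card).
  by have /card_eqPle[] := inj_card_eq Dinj.
apply: subset_card_le => _ [[[|[|[|//]]] i3] _ <-] /=.
- by exists x => // /esym.
- by exists y => // /esym.
- by exists z => // /esym.
Qed.

Hypothesis Xcut : forall x y, x <> y -> exists2 w, Br w & cuts w x y.

(** A connected open set with two points contains any branch point cutting them. An open set with a
    single point would be clopen, hence the whole space. *)
Lemma Br_dense x0 y0 : x0 <> y0 -> dense (@Br X).
Proof.
move=> xy0 U [p Up] Uo.
have [V [oV Vp VU Vc]] := Xloc (open_nbhs_nbhs (conj Uo Up)).
have [[q [Vq qp]]|nq] := pselect (exists q, V q /\ q <> p).
  have [w Bw [wq wp nqp]] := Xcut qp.
  exists w; split=> //; apply: VU; apply: contrapT => nVw; apply: nqp.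
  exact: (component_at_max Vc Vq nVw).
have Vp1 : V = [set p].
  apply/seteqP; split=> [q Vq|_ -> //].
  by apply: contrapT => qp; apply: nq; exists q.
have VT : V = setT.
  apply: Xconn; first by exists p.
    by exists V; rewrite ?setTI.
  exists V; rewrite ?setTI // Vp1.
  exact/accessible_closed_set1/hausdorff_accessible.
have e x : x = p by have : setT x by []; rewrite -VT Vp1.
by case: xy0; rewrite (e x0) (e y0).
Qed.

(** If [m] and [m'] differed, all but at most one of the three points would lie in the component at
    [m] containing [m'], but [m] cuts every two of them. *)
Lemma Br_determined_by_three m m' p q r : cuts m p q -> cuts m q r -> cuts m p r ->
  cuts m' p q -> cuts m' q r -> cuts m' p r -> m = m'.
Proof.
move=> [mp mq m1] [_ mr m2] [_ _ m3] [mp' mq' m1'] [_ mr' m2'] [_ _ m3'].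
apply: contrapT => mm'.
have aux a b : ~ comp m' a b -> comp m m' a \/ comp m m' b.
  move=> nab; have [?|na] := pselect (comp m m' a); first by left.
  have [?|nb] := pselect (comp m m' b); first by right.
  case: nab; have := component_at_opp Xhaus Xconn Xloc mm' na.
  move=> /component_at_sym ha.
  rewrite (component_at_eq ha); exact: component_at_opp.
have aux' a b : comp m m' a -> comp m m' b -> comp m a b.
  by move=> ha hb; rewrite -(component_at_eq ha).
case: (aux _ _ m1') (aux _ _ m2') (aux _ _ m3') => [?|?] [?|?] [?|?];
  by [apply: m1; exact: aux'|apply: m2; exact: aux'|apply: m3; exact: aux'].
Qed.

End BranchPoints.

(** * Cut points of the dendrite *)

Section Arcs.
Variables (R : realType) (X : topologicalType).
Implicit Types x y z w a : X.
Local Notation comp := (@component_at X).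

Lemma arc_component_at x y w (A : set X) : is_arc R x y A -> comp w x y ->
  A `<=` w |` comp w x.
Proof.
move=> [f [[fc [g [gc fK gK]]] f0 f1]] xy a Aa.
have [->|aw] := pselect (a = w); [by left|right].
(* Clamping to the unit interval extends the parametrization to the real line, where segments are
   known to be connected. *)
pose clamp (r : R) : R := Num.min 1%R (Num.max 0%R r).
have clampE r : (0 <= r <= 1)%R -> clamp r = r.
  by move=> /andP[r0 r1]; rewrite /clamp (max_idPr r0) (min_idPr r1).
have clampP r : clamp r \in (`[0%R, 1%R]%classic : set R).
  rewrite inE /= in_itv /= /clamp le_min ler01 le_max lexx /=.
  by rewrite ge_min lexx.
pose h r : set_type (`[0%R, 1%R]%classic : set R) := exist _ (clamp r) (clampP r).
have hE r : set_val (h r) = clamp r by rewrite set_valE.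
have hc : continuous h.
  apply: continuous_comp_initial.
  have -> : set_val \o h = clamp by apply/funext => r /=; exact: hE.
  move=> r; apply: continuous_min; first exact: cvg_cst.
  by apply: continuous_max; [exact: cvg_cst|exact: cvg_id].
pose F r : X := set_val (f (h r)).
have Fc : continuous F.
  move=> r; apply: (@continuous_comp _ _ _ (f \o h) set_val).
    by apply: continuous_comp; [exact: hc|exact: fc].
  exact: initial_continuous.
have Finj r s : (0 <= r <= 1)%R -> (0 <= s <= 1)%R -> F r = F s -> r = s.
  move=> r01 s01; rewrite /F !set_valE => /val_inj/(can_inj fK)/(congr1 set_val).
  by rewrite !hE !clampE.
have F0 : F 0%R = x by apply: f0; rewrite hE clampE // lexx ler01.
have F1 : F 1%R = y by apply: f1; rewrite hE clampE // lexx ler01.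
have [t t01 Ft] : exists2 t, (0 <= t <= 1)%R & F t = a.
  pose s := g (exist _ a (mem_set Aa)); exists (set_val s).
    by have := set_valP s; rewrite /= in_itv.
  rewrite /F; have -> : h (set_val s) = s.
    apply: val_inj => /=; rewrite clampE ?set_valE //.
    by have := set_valP s; rewrite /= in_itv.
  by rewrite /s gK set_valE.
have seg u v : connected (F @` `[u, v]).
  apply: connected_continuous_connected; first exact: segment_connected.
  exact: continuous_subspaceT.
have /andP[t0 t1] := t01.
(* By injectivity [w] lies on at most one side of [a] on the arc; the other subarc joins [a] to an
   end point without meeting [w]. *)
have [[u [/andP[u0 ut] Fu]]|nu] := pselect (exists u, (0 <= u <= t)%R /\ F u = w).
  rewrite (component_at_eq xy) -Ft.
  apply: (component_at_max (seg t 1%R)).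
  - by exists 1%R => //=; rewrite in_itv /= t1 lexx.
  - move=> [v /=]; rewrite in_itv /= => /andP[tv v1] Fv; apply: aw.
    suff tu : t = u by rewrite -Ft tu.
    apply/eqP; rewrite eq_le ut andbT.
    have <- // : v = u.
    apply: Finj; rewrite ?Fv //; first by rewrite v1 (le_trans t0).
    by rewrite u0 (le_trans ut).
  - by exists t => //=; rewrite in_itv /= t1 lexx.
rewrite -Ft; apply: (component_at_max (seg 0%R t)).
- by exists 0%R => //=; rewrite in_itv /= t0 lexx.
- move=> [v /=]; rewrite in_itv /= => vt Fv; apply: nu; by exists v.
- by exists t => //=; rewrite in_itv /= t0 lexx.
Qed.

Lemma open_arc_component_at x y w a : open_arc R x y a -> comp w x y -> a <> w ->
  comp w x a.
Proof.
move=> [xya _] wxy aw; suff /arc_component_at h : is_arc R x y (the_arc R x y).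
  by have [|] := h _ wxy _ xya.
(* The default [set0] is excluded because [a] lies on the arc. *)
rewrite /the_arc; case: xgetP => [//|none].
by move: xya; rewrite /the_arc xgetPN.
Qed.

End Arcs.

Lemma three_colors n : at_least3 n ->
  exists i j k : color n, [/\ i <> j, j <> k & i <> k].
Proof.
move=> n3; have ok m : (m < 3)%N -> below n m.
  by case: n n3 => //= k k3 /leq_trans; apply.
by exists (exist _ 0%N (ok 0%N isT)), (exist _ 1%N (ok 1%N isT)),
  (exist _ 2%N (ok 2%N isT)).
Qed.

(** * The color tree of the branch points *)

Section BranchColors.
Variables (R : realType) (n : option nat) (X : topologicalType)
  (c : X -> set X -> color n).
Hypotheses (hn : at_least3 n) (hX : wazewski_dendrite R n X)
  (hc : kaleidoscopic R c).
Implicit Types (x y z w : X) (a b : set_type (@Br X)).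
Local Notation comp := (@component_at X).

Lemma dendrite_hausdorff : hausdorff_space X.
Proof.
have [[[_ _ _ [M [f [fc [g [_ fK _]]]]]] _ _] _ _ _] := hX.
move=> x y xy; apply: (can_inj fK); apply: metric_hausdorff => U V Ux Vy.
have [z [zU zV]] := xy _ _ (fc _ _ Ux) (fc _ _ Vy).
by exists (f z).
Qed.
Let Xhaus := dendrite_hausdorff.

Lemma dendrite_connected : connected [set: X].
Proof. by have [[[]]] := hX. Qed.
Let Xconn := dendrite_connected.

Lemma dendrite_locally_connected : locally_connected X.
Proof. by have [[]] := hX. Qed.
Let Xloc := dendrite_locally_connected.

Lemma color_component_eq x y z : Br x -> y <> x -> z <> x ->
  c x (comp x y) = c x (comp x z) <-> comp x y z.
Proof.
move=> Bx yx zx; split=> [e|/component_at_eq -> //].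
have [_ inj _] := hc.1 x Bx.
have -> : comp x y = comp x z.
  by apply: inj; rewrite ?inE //; [exists y|exists z].
exact: component_at_refl.
Qed.

Lemma kaleidoscopic_cuts x y i j : Br x -> Br y -> x <> y -> i <> j ->
  exists w, [/\ Br w, cuts w x y, c w (comp w x) = i & c w (comp w y) = j].
Proof.
move=> Bx By xy ij; have [w [[_ nw] Bw ei ej]] := hc.2 x y Bx By xy i j ij.
exists w; split=> //; split.
- by move=> wx; apply: nw; left.
- by move=> wy; apply: nw; right.
- by move=> /component_at_eq e; apply: ij; rewrite -ei -ej e.
Qed.

(* If no branch point cuts [x] from [y], then for a branch point [w] the arc
   from [x] to [y] meets only one branch at [w], and so does the arc from [x]
   to any branch point on it: two such branch points could not be cut. *)
Lemma dendrite_cut x y : x <> y -> exists2 w, Br w & cuts w x y.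
Proof.
move=> xy; apply: contrapT => ncut.
have same w : Br w -> w <> x -> w <> y -> comp w x y.
  move=> Bw wx wy; apply: contrapT => nxy; apply: ncut; exists w => //.
have [_ _ _ arcs] := hX.
have [p [xyp Bp]] := arcs x y xy.
have [_ npxy] := xyp.
have xp : x <> p by move=> e; apply: npxy; left.
have [q [xpq Bq]] := arcs x p xp.
have [_ nqxp] := xpq.
have pq : p <> q by move=> e; apply: nqxp; right.
have nocut w : Br w -> cuts w p q -> w = x \/ w = y.
  move=> Bw [wp wq npq]; apply: contrapT => nwxy; apply: npq.
  have wx : w <> x by move=> e; apply: nwxy; left.
  have wy : w <> y by move=> e; apply: nwxy; right.
  have wxp : comp w x p.
    by apply: (open_arc_component_at xyp); [exact: same|exact/nesym].
  rewrite -(component_at_eq wxp).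
  by apply: (open_arc_component_at xpq wxp); exact/nesym.
(* Three branch points between [p] and [q] with different colors towards [p] are distinct, yet each
   would have to be [x] or [y]. *)
have [i [j [k [ij jk ik]]]] := three_colors hn.
have [w1 [B1 s1 e1 _]] := kaleidoscopic_cuts Bp Bq pq ij.
have [w2 [B2 s2 e2 _]] := kaleidoscopic_cuts Bp Bq pq jk.
have [w3 [B3 s3 e3 _]] := kaleidoscopic_cuts Bp Bq pq (nesym ik).
case: (nocut _ B1 s1) (nocut _ B2 s2) (nocut _ B3 s3) e1 e2 e3 =>
  -> [] -> [] -> e1 e2 e3; congruence.
Qed.
Let Xcut := dendrite_cut.

Lemma dendrite_Br_dense : dense (@Br X).
Proof. by have [_ [x [y xy]] _ _] := hX; exact: (Br_dense Xhaus Xconn Xloc Xcut xy). Qed.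

Lemma component_at_Br x y : y <> x -> exists b, comp x y (set_val b).
Proof.
move=> yx; have [|z [xyz Bz]] := dendrite_Br_dense _ (component_at_open Xhaus Xloc x y).
  by exists y; exact: component_at_refl.
by exists (exist _ z (mem_set Bz)).
Qed.

Definition branch_color a b : color n := c (set_val a) (comp (set_val a) (set_val b)).
Local Notation col := branch_color.

Lemma Br_neq a b : a != b -> set_val a <> set_val b.
Proof. by move=> ab e; move/eqP: ab; apply; exact: val_inj. Qed.

Lemma branch_color_eq a b b' : b != a -> b' != a ->
  col a b = col a b' <-> comp (set_val a) (set_val b) (set_val b').
Proof.
move=> ba b'a; apply: color_component_eq; [exact: set_valP|exact: Br_neq..].
Qed.

Lemma separates_cuts m a b :
  separates col m a b <-> cuts (set_val m) (set_val a) (set_val b).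
Proof.
rewrite /separates; split.
  move=> /and3P[ma mb /eqP ne]; split; [exact: Br_neq..|].
  by move/(branch_color_eq _ _); rewrite !(eq_sym _ m) => /(_ ma mb).
move=> [ma mb nab].
have ma' : m != a by apply/eqP => e; apply: ma; rewrite e.
have mb' : m != b by apply/eqP => e; apply: mb; rewrite e.
rewrite ma' mb'; apply/eqP => e; apply: nab.
by apply/branch_color_eq => //; rewrite eq_sym.
Qed.

Lemma branch_color_tree : color_tree col.
Proof.
split.
- move=> a b b' ab ab' /eqP ne; apply/branch_color_eq => //.
    apply/eqP => e; apply: ne; congr col; exact/esym.
  apply: component_at_opp => //; first exact: Br_neq.
  by move=> h; apply: ne; apply/branch_color_eq => //; rewrite eq_sym.
- have nsep a b b' : ~~ separates col a b b' ->
      ~ cuts (set_val a) (set_val b) (set_val b').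
    by move/negP => h /separates_cuts.
  move=> x y z /Br_neq xy /Br_neq yz /Br_neq xz /nsep n1 /nsep n2 /nsep n3.
  have [m [m1 m2 m3]] := median_exists Xhaus Xconn Xloc Xcut xy yz xz n1 n2 n3.
  exists (exist _ m (mem_set (cuts3_Br m1 m2 m3))).
  by apply/and3P; split; apply/separates_cuts.
- move=> x y i j /Br_neq xy /eqP ij.
  have [w [Bw [wx wy _] ei ej]] :=
    kaleidoscopic_cuts (set_valP x) (set_valP y) xy ij.
  exists (exist _ w (mem_set Bw)); split => //.
    by apply/eqP => e; apply: wx; rewrite -e.
  by apply/eqP => e; apply: wy; rewrite -e.
- move=> x i; have [_ _ surj] := hc.1 _ (set_valP x).
  have [_ [y /= yx <-] ei] := surj i I.
  have [b xyb] := component_at_Br yx; exists b.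
    by apply/eqP => e; move/component_at_neq: xyb; rewrite e.
  by rewrite /branch_color -(component_at_eq xyb).
- move=> i; have [j [k [_ [jk _ _]]]] := three_colors hn.
  have [e|ne] := eqVneq j i; last by exists j.
  by exists k; rewrite -e; apply/eqP/nesym.
Qed.

Lemma branch_color_surj x i : Br x -> exists b, set_val b <> x /\ c x (comp x (set_val b)) = i.
Proof.
move=> Bx; have [_ _ surj] := hc.1 _ Bx.
have [_ [y /= yx <-] ei] := surj i I.
have [b xyb] := component_at_Br yx; exists b; split.
  exact: component_at_neq xyb.
by rewrite -(component_at_eq xyb).
Qed.

Lemma Br_nonempty : exists b : set_type (@Br X), True.
Proof.
have [_ [x [y xy]] _ _] := hX; have [w Bw _] := Xcut xy.
by exists (exist _ w (mem_set Bw)).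
Qed.

(** A branch point is coded by three points of a countable dense set in different components at it;
    it is recovered as their median. *)
Lemma Br_enum : exists e : nat -> set_type (@Br X), forall b, exists k, e k = b.
Proof.
have [b0 _] := Br_nonempty.
have [[[_ Xcomp _ Xmet] _ _] _ _ _] := hX.
have [D [Dc Dd]] := compact_metrizable_dense Xcomp Xmet.
have [code codeinj] := countable_injP _ Dc.
have [i [j [k [ij jk ik]]]] := three_colors hn.
have pick b l : exists p, [/\ D p, p <> set_val b & c (set_val b) (comp (set_val b) p) = l].
  have [b' [b'b e]] := branch_color_surj l (set_valP b).
  have [|p [bp Dp]] := Dd _ _ (component_at_open Xhaus Xloc (set_val b) (set_val b')).
    by exists (set_val b'); exact: component_at_refl.
  exists p; split=> //; first exact: component_at_neq bp.
  by rewrite -(component_at_eq bp).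
pose P b l := projT1 (cid (pick b l)).
have PP b l : [/\ D (P b l), P b l <> set_val b & c (set_val b) (comp (set_val b) (P b l)) = l].
  exact: projT2 (cid (pick b l)).
apply: (@enum_of_inj _ (nat * nat * nat)%type
  (fun b => (code (P b i), code (P b j), code (P b k))) b0) => b b'.
have cutsP d l m : l <> m -> cuts (set_val d) (P d l) (P d m).
  have [_ n1 e1] := PP d l; have [_ n2 e2] := PP d m.
  move=> lm; split; [exact/nesym..|].
  by move=> /component_at_eq e; apply: lm; rewrite -e1 -e2 e.
have inj l : code (P b l) = code (P b' l) -> P b l = P b' l.
  by apply: codeinj; rewrite inE; have [] := PP b l; have [] := PP b' l.
move=> [/inj ei /inj ej /inj ek]; apply: val_inj.
have := (cutsP b' _ _ ij, cutsP b' _ _ jk, cutsP b' _ _ ik).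
rewrite -ei -ej -ek => -[[h1 h2] h3].
exact: (Br_determined_by_three Xhaus Xconn Xloc (cutsP b _ _ ij) (cutsP b _ _ jk)
  (cutsP b _ _ ik) h1 h2 h3).
Qed.

End BranchColors.

(** * Extension of permutations of the branch points *)

Section Extension.
Variables (R : realType) (n : option nat) (X : topologicalType)
  (c : X -> set X -> color n).
Hypotheses (hn : at_least3 n) (hX : wazewski_dendrite R n X)
  (hc : kaleidoscopic R c).
Local Notation B := (set_type (@Br X)).
Local Notation comp := (@component_at X).
Implicit Types (p q : X) (a b : B) (s t : B -> B).
Let Xhaus := dendrite_hausdorff hX.
Let Xconn := dendrite_connected hX.
Let Xloc := dendrite_locally_connected hX.
Let Xcut := dendrite_cut hn hX hc.

Definition preserves_branches s := forall a b b', b != a -> b' != a ->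
  comp (set_val a) (set_val b) (set_val b') <->
  comp (set_val (s a)) (set_val (s b)) (set_val (s b')).

Lemma preserves_branches_inv s t : cancel s t -> cancel t s ->
  preserves_branches s -> preserves_branches t.
Proof.
move=> sK tK sh a b b' ba b'a.
have neq d d' : d != d' -> t d != t d' by rewrite (inj_eq (can_inj tK)).
by have := sh _ _ _ (neq _ _ ba) (neq _ _ b'a); rewrite !tK; split=> /H.
Qed.

(** [q] is a possible value at [p] of an extension of [s]: it lies in the images of exactly those
    half-spaces that contain [p]. *)
Definition extends s p q := forall a b, b != a ->
  comp (set_val a) (set_val b) p <-> comp (set_val (s a)) (set_val (s b)) q.

Lemma extends_uniq s t p q q' : cancel t s -> extends s p q -> extends s p q' ->
  q = q'.
Proof.
move=> tK pq pq'; apply: contrapT => qq'.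
have [w Bw [wq wq' nqq']] := Xcut qq'.
pose w' : B := exist _ w (mem_set Bw).
have [b wb] := component_at_Br hn hX hc (nesym wq).
have wE : set_val (s (t w')) = w by rewrite tK.
have ba : t b != t w'.
  rewrite (inj_eq (can_inj tK)); apply/eqP => e.
  by have := component_at_neq wb; rewrite e.
have := pq _ _ ba; have := pq' _ _ ba; rewrite wE tK => h' h.
apply: nqq'; rewrite (component_at_eq wb); apply/h'/h.
exact: component_at_sym.
Qed.

(** At a branch point the value is given by [s]. Elsewhere it is a cluster point of the images of
    the branch points near [p], which exists by density and compactness. *)
Lemma extends_exists s t p : cancel s t -> cancel t s -> preserves_branches s ->
  exists q, extends s p q.
Proof.
move=> sK tK sh; have sinj := can_inj sK.
have out a b : ~ comp (set_val a) (set_val b) (set_val a).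
  by move/component_at_neq.
have hom a b b' : b != a -> comp (set_val a) (set_val b) (set_val b') <->
    comp (set_val (s a)) (set_val (s b)) (set_val (s b')).
  move=> ba; have [->|b'a] := eqVneq b' a; last exact: sh.
  by split=> /out.
have [Bp|nBp] := pselect (Br p).
  pose p' : B := exist _ p (mem_set Bp).
  by exists (set_val (s p')) => a b ba; exact: (hom a b p' ba).
pose F : set_system X := [set A | exists2 U, nbhs p U &
  forall b, U (set_val b) -> A (set_val (s b))].
have FF : ProperFilter F.
  split.
    move=> [U]; rewrite nbhsE => -[V [Vo Vp] VU] h.
    have [|z [Vz Bz]] := dendrite_Br_dense hn hX hc _ Vo; first by exists p.
    exact: (h (exist _ z (mem_set Bz)) (VU _ Vz)).
  split; first by exists setT => //; exact: filterT.
    move=> P Q [U Up hU] [V Vp hV]; exists (U `&` V); first exact: filterI.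
    by move=> b [/hU ? /hV].
  by move=> P Q PQ [U Up hU]; exists U => // b /hU /PQ.
have Xcomp : compact [set: X] by have [[[]]] := hX.
have [q [_ Fq]] := Xcomp F FF filterT.
have cl a b : comp (set_val a) (set_val b) p -> b != a ->
    (set_val (s a) |` comp (set_val (s a)) (set_val (s b))) q.
  move=> abp ba; apply: (component_at_closure Xhaus Xloc).
  move=> U Uq; apply: Fq => //.
  exists (comp (set_val a) (set_val b)).
    by apply: open_nbhs_nbhs; split=> //; exact: component_at_open.
  by move=> b' /(hom _ _ _ ba).
(* A branch point [w] cutting [p] from [a] keeps [q] in a closed half-space at [s w] that misses
   [s a]. *)
have qB a : q <> set_val (s a).
  move=> qa; have pa : p <> set_val a.
    by move=> e; apply: nBp; rewrite e; exact: set_valP.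
  have [w Bw [wp wa npa]] := Xcut pa.
  pose w' : B := exist _ w (mem_set Bw).
  have [b wb] := component_at_Br hn hX hc (nesym wp).
  have bw' : b != w' by apply/eqP => e; have := component_at_neq wb; rewrite e.
  have [|e|] := cl w' b _ bw'; first exact: component_at_sym.
    move: qa; rewrite e => /val_inj/sinj e'.
    by apply: wa; rewrite -e'.
  rewrite qa => /(hom _ _ _ bw') h; apply: npa.
  by rewrite (component_at_eq wb).
exists q => a b ba; split=> [abp|abq]; first by have [/qB|] := cl a b abp ba.
(* For the converse, the component at [a] containing [p] has an image containing [q]; so its image
   is the given component, and the two components at [a] agree. *)
have pa : p <> set_val a by move=> e; apply: nBp; rewrite e; exact: set_valP.
have [b' ab'] := component_at_Br hn hX hc pa.
have b'a : b' != a by apply/eqP => e; have := component_at_neq ab'; rewrite e.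
have [|/qB//|ab'q] := cl a b' _ b'a; first exact: component_at_sym.
suff /component_at_eq -> : comp (set_val a) (set_val b) (set_val b').
  exact: component_at_sym.
apply/hom => //; rewrite (component_at_eq abq); exact: component_at_sym.
Qed.

(* The graph is closed, since distinct points have disjoint half-space
   neighbourhoods, and the target is compact. *)
Lemma extends_continuous s t (g : X -> X) : cancel t s ->
  (forall p, extends s p (g p)) -> continuous g.
Proof.
move=> tK gP p V Vgp.
have gopen w y : Br w -> y <> w -> open (g @^-1` comp w y).
  move=> Bw yw; pose w' : B := exist _ w (mem_set Bw).
  have [b wb] := component_at_Br hn hX hc yw.
  have wE : set_val (s (t w')) = w by rewrite tK.
  have ba : t b != t w'.
    rewrite (inj_eq (can_inj tK)); apply/eqP => e.
    by have := component_at_neq wb; rewrite e.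
  have hz z : comp (set_val (t w')) (set_val (t b)) z <->
      comp w (set_val b) (g z).
    by have := gP z _ _ ba; rewrite wE tK.
  have -> : g @^-1` comp w y = comp (set_val (t w')) (set_val (t b)).
    by apply/seteqP; split=> z; rewrite /= (component_at_eq wb) => /hz.
  exact: component_at_open.
have Xcomp : compact [set: X] by have [[[]]] := hX.
have cov := (compact_near_coveringP [set: X]).1 Xcomp _ (nbhs p)
  (fun z x' => g z = x' -> V x') (nbhs_filter p).
suff /cov : forall x, [set: X] x ->
    \forall x' \near x & z \near nbhs p, g z = x' -> V x'.
  by apply: filterS => z h; exact: h.
move=> x _; have [->|xgp] := pselect (x = g p).
  exists (V, setT) => /=; first by split=> //; exact: filterT.
  by move=> [x' z] /= [Vx' _].
have [w Bw [wx wgp nx]] := Xcut xgp.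
exists (comp w x, g @^-1` comp w (g p)) => /=.
  split; apply: open_nbhs_nbhs; split.
  + exact: component_at_open.
  + exact/component_at_refl/nesym.
  + exact/gopen/nesym.
  + exact/component_at_refl/nesym.
move=> [x' z] /= [wx' wz] e; case: nx; rewrite (component_at_eq wx') -e.
exact: component_at_sym.
Qed.

(** The extensions of [s] and [t] are mutually inverse because values of extensions are unique. *)
Lemma extension_homeomorphism s t : cancel s t -> cancel t s ->
  preserves_branches s ->
  exists g : X -> X, homeomorphism g /\ forall b, g (set_val b) = set_val (s b).
Proof.
move=> sK tK sh; have th := preserves_branches_inv sK tK sh.
have eg p := cid (extends_exists p sK tK sh).
have eh p := cid (extends_exists p tK sK th).
pose g p := projT1 (eg p); pose h p := projT1 (eh p).
have gP p : extends s p (g p) := projT2 (eg p).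
have hP p : extends t p (h p) := projT2 (eh p).
have inv s1 t1 p q : cancel s1 t1 -> cancel t1 s1 -> extends s1 p q ->
    extends t1 q p.
  move=> s1K t1K pq a b ba; have neq : t1 b != t1 a.
    by rewrite (inj_eq (can_inj t1K)).
  by have := pq _ _ neq; rewrite !t1K => -[? ?]; split.
exists g; split; first split.
- exact: extends_continuous tK gP.
- exists h; split.
  + exact: extends_continuous sK hP.
  + by move=> p; apply: (extends_uniq sK (hP _)); exact: inv (gP p).
  + by move=> p; apply: (extends_uniq tK (gP _)); exact: inv (hP p).
move=> b; apply: (extends_uniq tK (gP _)) => a b' b'a.
have [->|ba] := eqVneq b a; last exact: sh.
by split=> /component_at_neq.
Qed.

Lemma homeomorphism_component g p q : homeomorphism g ->
  g @` comp p q = comp (g p) (g q).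
Proof.
have sub f r u v : continuous f -> cancel f r -> v <> u ->
    f @` comp u v `<=` comp (f u) (f v).
  move=> fc fK vu; apply: component_at_max.
  - apply: connected_continuous_connected; first exact: component_connected.
    exact: continuous_subspaceT.
  - by exists v => //; exact: component_at_refl.
  - by move=> [z uz /(can_inj fK) zu]; apply: (component_at_neq uz).
move=> [gc [h [hcont gK hK]]]; have [->|qp] := pselect (q = p).
  by rewrite !component_at_out image_set0.
apply/seteqP; split; first exact: sub gc gK qp.
move=> z gz; exists (h z) => //.
have := sub h g (g p) (g q) hcont hK; rewrite !gK; apply; last by exists z.
by move/(can_inj gK).
Qed.

End Extension.

(** * Kaleidoscopic groups *)

Section SymClosed.
Variable T : choiceType.
Implicit Types (s t : Sym T) (A : set (Sym T)) (F : seq T).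

Definition agree_on F s t := forall x, x \in F -> Sym_fun t x = Sym_fun s x.

Lemma nbhs_agree_on s F : nbhs s [set t | agree_on F s t].
Proof.
elim: F => [|x F IHF]; first by apply: filterS (filterT : nbhs s _) => t _ x.
have ev : nbhs s [set t | Sym_fun t x = Sym_fun s x].
  have : nbhs (set_val s : {ptws T -> discrete_topology T})
      (@proj T (fun=> discrete_topology T) x @^-1` [set Sym_fun s x]).
    by apply: proj_continuous; exact: (@discrete_set1 (discrete_topology T)).
  exact: (@initial_continuous _ _ set_val s).
apply: filterS2 ev IHF => t tx tF y; rewrite inE => /predU1P[->//|].
exact: tF.
Qed.

Lemma closure_Sym A s : closure A s <->
  forall F, exists2 t, A t & agree_on F s t.
Proof.
split=> [As F|h U].
  by have [t [At st]] := As _ (nbhs_agree_on s F); exists t.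
rewrite nbhsE => -[_ [[V Vo <-] Vs] VU].
(* The filter generated by agreement with [s] on finite sets converges to [s] pointwise. *)
pose G := filter_from [set: seq T]
  (fun F => [set f : {ptws T -> discrete_topology T} | forall x, x \in F -> f x = Sym_fun s x]).
have GF : Filter G.
  apply: filter_from_filter; first by exists [::].
  move=> F F' _ _; exists (F ++ F') => // f fs.
  by split=> x xF; apply: fs; rewrite mem_cat xF ?orbT.
have Gs : G --> (set_val s : {ptws T -> discrete_topology T}).
  apply/(pointwise_cvgP (U := discrete_topology T)
    (V := discrete_topology T)) => x.
  apply/discrete_cvg; exists [:: x] => // f; apply; exact: mem_head.
have [F _ FV] : G V by apply: Gs; apply: open_nbhs_nbhs.
have [t At st] := h F; exists t; split=> //; apply: VU; exact: FV.
Qed.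

Lemma closed_Sym A : closed A <->
  forall s, (forall F, exists2 t, A t & agree_on F s t) -> A s.
Proof.
split=> [Ac s /closure_Sym|h s /closure_Sym/h//]; exact: Ac.
Qed.
End SymClosed.

(** * Closedness of the kaleidoscopic group and of [Gamma] *)

Section Group.
Variables (R : realType) (n : option nat) (X : topologicalType)
  (c : X -> set X -> color n) (Gamma : set (Sym (color n))).
Hypotheses (hn : at_least3 n) (hX : wazewski_dendrite R n X)
  (hc : kaleidoscopic R c) (hGamma : group_closed (mem Gamma)).
Local Notation B := (set_type (@Br X)).
Local Notation comp := (@component_at X).
Local Notation col := (@branch_color n X c).
Implicit Types (a b : B) (s t : Sym B) (gam : Sym (color n)).

Lemma branch_color_inh a i : exists b, b != a /\ col a b = i.
Proof.
have [b ba e] := color_surj (branch_color_tree hn hX hc) a i.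
by exists b.
Qed.

Lemma local_action_color (g : X -> X) a x : homeomorphism g -> x <> set_val a ->
  local_action c g (set_val a) (c (set_val a) (comp (set_val a) x)) =
  c (g (set_val a)) (comp (g (set_val a)) (g x)).
Proof.
move=> gh xa; rewrite /local_action pinvKV; first by rewrite homeomorphism_component.
  by have [_ inj _] := hc.1 _ (set_valP a).
by rewrite inE; exists x.
Qed.

(** Homeomorphisms are eliminated: color permutations are injective, so [s] preserves components and
    extends. Every color at a branch point is realized by another branch point, which determines the
    local action. *)
Lemma on_Br_kaleidoscopicP s : on_Br (kaleidoscopic_group c Gamma) s <->
  forall a, exists2 gam, Gamma gam &
    forall b, b != a -> col (Sym_fun s a) (Sym_fun s b) = Sym_fun gam (col a b).
Proof.
split=> [[g [gh gG] sg] a|h].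
  have [gam Ggam e] := gG _ (set_valP a); exists gam => // b ba.
  rewrite e /branch_color (local_action_color gh) ?sg //.
  exact: Br_neq.
have [t sK tK] := Sym_bij s; have sinj := can_inj sK.
have [|g [gh gs]] := extension_homeomorphism hn hX hc sK tK.
  move=> a b b' ba b'a; have [gam _ e] := h a.
  rewrite -(branch_color_eq hc ba b'a) -(branch_color_eq hc) ?(inj_eq sinj) //.
  rewrite !e //; split=> [->//|]; exact: (bij_inj (Sym_bij gam)).
exists g => //; split=> // x Bx; pose a : B := exist _ x (mem_set Bx).
have [gam Ggam e] := h a; exists gam => //; apply/funext => i.
have [b [ba <-]] := branch_color_inh a i.
rewrite -e // (local_action_color (a := a) gh); last exact: Br_neq.
by rewrite /branch_color -!gs.
Qed.

Lemma closed_on_Br_kaleidoscopic :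
  closed Gamma -> closed (on_Br (kaleidoscopic_group c Gamma)).
Proof.
move=> /closed_Sym Gc; apply/closed_Sym => s hs.
apply/on_Br_kaleidoscopicP => a.
pose r i := projT1 (cid (branch_color_inh a i)).
have ra i : r i != a by have [] := projT2 (cid (branch_color_inh a i)).
have rc i : col a (r i) = i by have [] := projT2 (cid (branch_color_inh a i)).
(* [f] is the candidate local action at [a], read off from one representative [r i] of each color.
   Approximation at two branch points shows independence of the representatives and injectivity. *)
pose f i := col (Sym_fun s a) (Sym_fun s (r i)).
have approx (L : seq B) : exists2 gam, Gamma gam & forall b, b \in L -> b != a ->
    col (Sym_fun s a) (Sym_fun s b) = Sym_fun gam (col a b).
  have [t /on_Br_kaleidoscopicP/(_ a)[gam Ggam e] st] := hs (a :: L).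
  exists gam => // b bL ba; rewrite -e // st ?mem_head //.
  by rewrite st // inE bL orbT.
have fE b : b != a -> col (Sym_fun s a) (Sym_fun s b) = f (col a b).
  move=> ba; have [gam _ e] := approx [:: b; r (col a b)].
  by rewrite /f !e ?inE ?eqxx ?orbT // rc.
have fbij : bijective f.
  rewrite -setTT_bijective; split=> // [i j _ _|j _].
    have [gam _ e] := approx [:: r i; r j].
    rewrite /f !e ?inE ?eqxx ?orbT // !rc; exact: (bij_inj (Sym_bij gam)).
  have [d [da dj]] := branch_color_inh (Sym_fun s a) j.
  have [t sK tK] := Sym_bij s.
  exists (col a (t d)) => //; rewrite -fE ?tK //.
  by rewrite -(inj_eq (can_inj sK)) tK.
exists (mk_Sym fbij) => //; apply: Gc => L.
have [gam Ggam e] := approx (map r L); exists gam => // i iL.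
rewrite -{1}(rc i) -e ?map_f //.
Qed.

Lemma closed_of_on_Br_kaleidoscopic :
  closed (on_Br (kaleidoscopic_group c Gamma)) -> closed Gamma.
Proof.
move=> /closed_Sym Kc; apply/closed_Sym => gam hgam.
have colT := branch_color_tree hn hX hc.
have [a0 _] := Br_nonempty hn hX hc.
have [e esurj] := Br_enum hn hX hc.
have [F [FP Floc]] := local_iso_family colT esurj a0.
have Fbij d : bijective (F (Sym_fun d)) by have [] := FP _ (Sym_bij d).
pose FS d : Sym B := mk_Sym (Fbij d).
have [|gam' Ggam' egam'] := (on_Br_kaleidoscopicP (FS gam)).1 _ a0.
  (* On [L] the permutation [FS gam] depends only on the values of [gam] at the colors of [L] at
     [a0], so an element of [Gamma] agreeing there gives an approximation. *)
  apply: Kc => L; have [d Gd gamd] := hgam (map (col a0) L).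
  exists (FS d); last first.
    by move=> b bL; apply: Floc; apply: gamd; exact: map_f.
  apply/on_Br_kaleidoscopicP => a; have [_ F0 Fc0 Fc] := FP _ (Sym_bij d).
  have [->|aa0] := eqVneq a a0.
    by exists d => // b ba; rewrite -Fc0 // -{2}F0.
  (* Away from [a0] the local action is trivial, and the subgroup contains the identity. *)
  exists 1%g; first by have [] := hGamma; rewrite inE.
  by move=> b ba; rewrite -[RHS]Fc.
suff -> : gam = gam' by [].
apply: Sym_funK => i; have [b [ba <-]] := branch_color_inh a0 i.
have [_ F0 Fc0 _] := FP _ (Sym_bij gam).
by rewrite -egam' // -Fc0 // -{1}F0.
Qed.

End Group.

(** A single finite list contains all colors, so an approximation on it is the permutation
    itself. *)
Lemma closed_Sym_finite (k : nat) (A : set (Sym (color (Some k)))) : closed A.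
Proof.
apply/closed_Sym => s /(_ (pmap insub (iota 0 k)))[t At st].
suff -> : s = t by [].
apply: Sym_funK => i; apply/esym/st.
by rewrite mem_pmap_sub mem_iota /=; exact: (valP i).
Qed.

Theorem theorem1p9 (R : realType) (n : option nat) (hn : at_least3 n)
  (X : topologicalType) (hX : wazewski_dendrite R n X)
  (c : X -> set X -> color n) (hc : kaleidoscopic R c)
  (Gamma : set (Sym (color n))) (hGamma : group_closed (mem Gamma)) :
  (closed (on_Br (kaleidoscopic_group c Gamma)) <-> closed Gamma) /\
  (n <> None -> closed Gamma).
Proof.
split; last by case: n hn hX c hc Gamma hGamma => // k *; exact: closed_Sym_finite.
split; first exact: closed_of_on_Br_kaleidoscopic hn hX hc hGamma.
exact: (closed_on_Br_kaleidoscopic hn hX hc).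
Qed.
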